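(* Let $J=[0,T]$ with $T>0$, let $0<\alpha<1$, let $f\in C(J\times\mathbb{R},\mathbb{R}\setminus\{0\})$ and $g\in C(J\times\mathbb{R},\mathbb{R})$, and suppose that for each $\tau\in J$ the map $x\mapsto \dfrac{x}{f(\tau,x)}$ is strictly increasing on $\mathbb{R}$. Let $v,w\in C(J)$ be such that the functions $\tau\mapsto \dfrac{v(\tau)}{f(\tau,v(\tau))}$ and $\tau\mapsto\dfrac{w(\tau)}{f(\tau,w(\tau))}$ have ABC-derivatives of order $\alpha$ belonging to $C(J)$, and suppose that (i) ${}^{ABC}{}_0\mathcal{D}^\alpha_\tau\left[\dfrac{v(\tau)}{f(\tau,v(\tau))}\right]\le g(\tau,v(\tau))$ for a.e. $\tau\in J$, (ii) ${}^{ABC}{}_0\mathcal{D}^\alpha_\tau\left[\dfrac{w(\tau)}{f(\tau,w(\tau))}\right]\ge g(\tau,w(\tau))$ for a.e. $\tau\in J$, where one of the two inequalities is strict. If $v(0)<w(0)$, then $v(\tau)<w(\tau)$ for all $\tau\in J$.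
   Context: $B$ is a fixed normalization function on $[0,1]$ with $B(\alpha)>0$ and $B(0)=B(1)=1$. $\mathbb{E}_\alpha(z)=\sum_{n=0}^\infty \frac{z^n}{\Gamma(n\alpha+1)}$ is the one-parameter Mittag-Leffler function. For $x\in H^1(0,T)$ the left Atangana--Baleanu--Caputo (ABC) fractional derivative of order $\alpha$ is $$ {}^{ABC}{}_0\mathcal{D}^\alpha_\tau x(\tau)=\frac{B(\alpha)}{1-\alpha}\int_0^\tau \mathbb{E}_\alpha\left[-\frac{\alpha}{1-\alpha}(\tau-\sigma)^\alpha\right]x'(\sigma)\,d\sigma ; $$ saying that $x$ has an ABC-derivative means $x\in H^1(0,T)$. *)

(* Defs.v *)
From HB Require Import structures.
From mathcomp Require Export all_boot all_order all_algebra.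
From mathcomp Require Export all_classical all_reals all_analysis.
Export numFieldNormedType.Exports.

Set Implicit Arguments.
Unset Strict Implicit.
Unset Printing Implicit Defensive.
Import Order.TTheory GRing.Theory Num.Theory.

Local Open Scope classical_set_scope.
Local Open Scope ring_scope.

Definition Gamma (R : realType) (s : R) : R :=
  \int[lebesgue_measure]_(t in `]0, +oo[) (t `^ (s - 1) * expR (- t)).

Definition mittag_leffler (R : realType) (a z : R) : R :=
  limn (series (fun n => z ^+ n / Gamma (n%:R * a + 1))).

Definition normalization_function (R : realType) (B : R -> R) : Prop :=
  [/\ forall a, 0 <= a <= 1 -> 0 < B a, B 0 = 1 & B 1 = 1].

(* x is in L^2(0, T): its extension by zero outside ]0, T[ is in L^2(R). *)
Definition L2 (R : realType) (T : R) (x : R -> R) : Prop :=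
  x \_ `]0, T[ \in Lfun (@lebesgue_measure R) 2%:E.

(* The test functions C_c^1(]0, T[), extended by zero to R. *)
Definition test_function (R : realType) (T : R) (phi : R -> R) : Prop :=
  [/\ forall t, derivable phi t 1,
      continuous (derive1 phi),
      compact (closure [set t | phi t != 0])
    & closure [set t | phi t != 0] `<=` `]0, T[].

(* y is a weak derivative of x on ]0, T[, square integrable.  Testing against
   C_c^1 is the definition of W^{1,p} of an interval in Brezis, Functional
   Analysis, Sobolev Spaces and Partial Differential Equations, Section 8.2. *)
Definition is_weak_derivative (R : realType) (T : R) (x y : R -> R) : Prop :=
  L2 T y /\
  forall phi, test_function T phi ->
    \int[lebesgue_measure]_(t in `]0, T[) (x t * derive1 phi t) =
    - \int[lebesgue_measure]_(t in `]0, T[) (y t * phi t).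

Definition H1 (R : realType) (T : R) (x : R -> R) : Prop :=
  L2 T x /\ exists y, is_weak_derivative T x y.

(* A weak derivative is unique only up to equality a.e. on ]0, T[; the choice
   of a representative does not affect the integral in ABC. *)
Definition weak_derivative (R : realType) (T : R) (x : R -> R) : R -> R :=
  xget (cst 0) [set y | is_weak_derivative T x y].

Definition ABC (R : realType) (B : R -> R) (T a : R) (x : R -> R) (t : R) : R :=
  B a / (1 - a) *
  \int[lebesgue_measure]_(s in `[0, t])
    (mittag_leffler a (- (a / (1 - a)) * (t - s) `^ a) *
     weak_derivative T x s).

(* Main.v *)
Require Import Defs.
From mathcomp Require Import measurable_realfun zify ring lra.
Import Order.TTheory GRing.Theory Num.Theory.

Local Open Scope classical_set_scope.
Local Open Scope ring_scope.

Set Implicit Arguments.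
Unset Strict Implicit.
Unset Printing Implicit Defensive.

(** Write K s for the kernel E_a(- lam s^a), with lam = a / (1 - a), and V, W
    for the quotients v / f(., v) and w / f(., w).  Since x |-> x / f(t, x) is
    strictly increasing, comparing v with w is comparing V with W, and these are
    continuous.  If the conclusion fails, let s > 0 be the first point at which
    W - V vanishes [first_crossing].  At s the right-hand sides coincide,
    and the two differential inequalities, which hold at every point by
    continuity [ae_le_within], give ABC V s <= ABC W s.  On the other hand
    V < W on [0, s[ and V s = W s force ABC W s < ABC V s [ABC_lt].

    The last inequality comes from the shape of the kernel.  For a nondecreasing
    weight phi >= 0 the integral of phi y is an average of the integrals of y over
    the superlevel sets of phi, which are final segments [c, s]
    [weighted_integral_ge0].  With y = (V - W)' and phi r = K (s - r), these
    integrals over final segments are W c - V c >= 0, with strict inequality at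
    c = 0; as K s > 0 the integral of phi y is positive.  This uses
    two facts.

    - A continuous function in H^1 is a primitive of its weak derivative
      [weak_derivative_FTC]: test the definition against smooth plateaus which
      converge to the indicator of an interval.

    - K is positive and nonincreasing [mittag_leffler_gt0,
      mittag_leffler_homo].  Here the kernel is obtained as a limit of a discrete
      one.  Let u_n be the coefficients of the power series
      (1-z)^(a-1) / ((1-z)^a + m).  Because (1-z)^a = 1 - sum_k c_k z^k with
      c_k >= 0 and sum_k c_k = 1, they solve the renewal equation
      (1 + m) u_n = sum_(k > n) c_k + sum_(1 <= k <= n) c_k u_(n-k),
      so that u_n is the survival probability of a renewal process killed with
      probability m / (1 + m) at each renewal.  Hence u is nonnegative,
      nonincreasing, and u_(n+p) >= u_n u_p [renewal_homo, renewal_supermul].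
      Expanding in m, u_n = sum_j (-m)^j G(n + a j + 1) / (G(a j + 1) n!) with G
      Euler's function; for m = N^(-a) and n ~ t N the j-th term tends to
      (- t^a)^j / G(a j + 1), by G(n + x + 1) ~ n! n^x, and Tannery's theorem
      yields u_n -> E_a(- t^a) [cvg_resolvent].  Positivity of the limit
      follows from positivity near 0 and E_a(- (2 t)^a) >= E_a(- t^a)^2. *)

(** * Integrability of real-valued combinations *)

Section real_integrable.
Context d (T : measurableType d) (R : realType) (mu : measure T R) (D : set T).
Implicit Types f g : T -> R.

Lemma Rintegrable_add f g : mu.-integrable D (EFin \o f) ->
  mu.-integrable D (EFin \o g) -> measurable D ->
  mu.-integrable D (EFin \o (fun x => f x + g x)).
Proof. by move=> If Ig mD; exact: (integrableD mD If Ig). Qed.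

Lemma Rintegrable_sub f g : mu.-integrable D (EFin \o f) ->
  mu.-integrable D (EFin \o g) -> measurable D ->
  mu.-integrable D (EFin \o (fun x => f x - g x)).
Proof. by move=> If Ig mD; exact: (integrableB mD If Ig). Qed.

Lemma Rintegrable_scale (k : R) f : mu.-integrable D (EFin \o f) -> measurable D ->
  mu.-integrable D (EFin \o (fun x => k * f x)).
Proof. by move=> If mD; exact: (integrableZl mD k If). Qed.
End real_integrable.

(** * Euler's Gamma function on [1, +oo[ *)

Section Gamma_function.
Context {R : realType}.
Local Notation mu := (@lebesgue_measure R).
Implicit Types (p s t c x : R).

Definition gamma_integrand p t : R := t `^ p * expR (- t).

Lemma measurable_gamma_integrand p (D : set R) :
  measurable_fun D (gamma_integrand p).
Proof.
apply: measurable_funTS; apply: measurable_funM; first exact: measurable_powR.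
by apply: measurableT_comp => //; exact: oppr_measurable.
Qed.

Lemma gamma_integrand_ge0 p t : 0 <= gamma_integrand p t.
Proof. by rewrite mulr_ge0 ?powR_ge0 ?expR_ge0. Qed.

(** With q = 2 (p + 1), t / q <= expR (t / q) raised to the power p gives
    t^p <= q^p expR (t / 2), a bound that is good enough for integrability. *)
Lemma powR_le_expR_half p : 0 <= p ->
  exists2 C : R, 0 < C & forall t, 0 <= t -> t `^ p <= C * expR (t / 2).
Proof.
move=> p0; exists ((2 * (p + 1)) `^ p).
  by rewrite powR_gt0// mulr_gt0// ltr_pwDr.
move=> t t0.
have p1 : 0 < p + 1 by rewrite ltr_pwDr.
have -> : t `^ p = (2 * (p + 1)) `^ p * (t / (2 * (p + 1))) `^ p.
  rewrite -powRM ?divr_ge0// ?mulr_ge0// ?(ltW p1)//.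
  by rewrite mulrCA divff ?mulr1// mulf_neq0// gt_eqF.
rewrite ler_wpM2l ?powR_ge0//.
have h : t / (2 * (p + 1)) <= expR (t / (2 * (p + 1))).
  by apply: le_trans (expR_ge1Dx _); rewrite lerDr.
apply: (@le_trans _ _ (expR (t / (2 * (p + 1))) `^ p)).
  by apply: ge0_ler_powR; rewrite // ?nnegrE ?expR_ge0// divr_ge0// mulr_ge0// ltW.
rewrite -expRM ler_expR invfM mulrA -mulrA ler_piMr ?divr_ge0//.
by rewrite mulrC ler_pdivrMr// mul1r lerDl.
Qed.

Lemma gamma_integrand_le p : 0 <= p ->
  exists2 C : R, 0 < C & forall t, 0 <= t -> gamma_integrand p t <= C * expR (- (t / 2)).
Proof.
move=> /powR_le_expR_half[C C0 hC]; exists C => // t t0.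
rewrite /gamma_integrand (le_trans (ler_wpM2r (expR_ge0 _) (hC _ t0)))//.
by rewrite -mulrA -expRD ler_pM2l// ler_expR; lra.
Qed.

Lemma cvg_expR_half : expR (- (t / 2)) @[t --> +oo] --> (0 : R).
Proof.
apply: (@cvg_comp _ _ _ (fun t : R => t / 2) (fun t => expR (- t)) _ (pinfty_nbhs R)).
  exact: gt0_cvgMly.
exact: cvgr_expR.
Qed.

Lemma gamma_integrand_cvg0 p : 0 <= p ->
  gamma_integrand p t @[t --> +oo] --> 0.
Proof.
move=> /gamma_integrand_le[C C0 hC].
apply: (@squeeze_cvgr _ _ _ _ (fun=> 0) (fun t => C * expR (- (t / 2)))); last 2 first.
- exact: cvg_cst.
- by rewrite -[X in _ --> X](mulr0 C); apply: cvgMr; exact: cvg_expR_half.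
near=> t; rewrite gamma_integrand_ge0/= hC//.
Unshelve. end_near. Qed.

Lemma gamma_integrand_cvg_right p : 0 <= p ->
  gamma_integrand p t @[t --> 0^'+] --> gamma_integrand p 0.
Proof.
move=> p0; apply: cvgM; last first.
  apply: cvg_at_right_filter.
  apply: (@continuous_comp _ _ _ (-%R) expR); first exact: opp_continuous.
  exact: continuous_expR.
have [->|pn0] := eqVneq p 0.
  by under eq_fun do rewrite powRr0; rewrite powRr0; exact: cvg_cst.
by rewrite powR0//; apply: powR_cvg0; rewrite lt_neqAle eq_sym pn0.
Qed.

Lemma is_derive_gamma_integrand s t : 0 < t ->
  is_derive t 1 (gamma_integrand s)
    (s * gamma_integrand (s - 1) t - gamma_integrand s t).
Proof.
move=> t0; rewrite /gamma_integrand.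
have h := is_derive1_powR s t0.
have h2 : is_derive t 1 (fun t => expR (- t)) (- expR (- t)).
  by apply: is_derive_eq; rewrite ?mulrN1 // scalerN scaler1.
apply: is_derive_eq.
rewrite /GRing.scale/=; lra.
Qed.

Lemma continuous_gamma_integrand p : 0 <= p ->
  {within `[0, +oo[, continuous (gamma_integrand p)}.
Proof.
move=> p0; apply/continuous_within_itvcyP; split; last exact: gamma_integrand_cvg_right.
move=> x; rewrite in_itv/= andbT => x0.
apply: differentiable_continuous; apply/derivable1_diffP.
by case: (is_derive_gamma_integrand p x0).
Qed.
Let continuous_expR_half : continuous (fun t : R => expR (- (t / 2))).
Proof.
move=> t; apply: (@continuous_comp _ _ _ (fun t => - (t / 2)) expR).
  by apply: cvgN; apply: cvgMl; exact: cvg_id.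
exact: continuous_expR.
Qed.

Let integral_expR_half :
  (\int[mu]_(t in `[0%R, +oo[) (expR (- (t / 2)))%:E = 2%:E)%E.
Proof.
have dF (t : R) : is_derive t 1 (fun t => - (2 * expR (- (t / 2)))) (expR (- (t / 2))).
  apply: is_derive_eq.
  by rewrite /GRing.scale/= !mulr1; field.
rewrite (@ge0_continuous_FTC2y _ _ (fun t => - (2 * expR (- (t / 2)))) _ 0).
- by rewrite mul0r oppr0 expR0 mulr1 EFinN oppeK add0e.
- by move=> x _; exact: expR_ge0.
- exact: continuous_subspaceT continuous_expR_half.
- rewrite -oppr0; apply: cvgN; rewrite -(mulr0 2); apply: cvgMr.
  exact: cvg_expR_half.
- by move=> x _; case: (dF x).
- apply: cvgN; apply: cvgMr; apply: cvg_at_right_filter; exact: continuous_expR_half.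
- by move=> x _; rewrite derive1E; case: (dF x).
Qed.

Let integrable_expR_half :
  mu.-integrable `]0, +oo[ (EFin \o (fun t => expR (- (t / 2)))).
Proof.
apply: (@integrableS _ _ _ mu `[0%R, +oo[%classic `]0, +oo[%classic _
  (measurable_itv _) (measurable_itv _)).
  by apply: subset_itvr; rewrite bnd_simp.
apply/integrableP; split.
  apply/measurable_EFinP; apply: measurable_funTS.
  exact: continuous_measurable_fun continuous_expR_half.
under eq_integral => x _ do rewrite /= ger0_norm ?expR_ge0//.
by rewrite integral_expR_half ltry.
Qed.

Let Rintegral_expR_half : \int[mu]_(t in `]0, +oo[) expR (- (t / 2)) = 2.
Proof.
rewrite Rintegral_itv_obnd_cbnd; last exact: integrable_expR_half.
by rewrite /Rintegral integral_expR_half.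
Qed.

Lemma integrable_gamma_integrand p : 0 <= p ->
  mu.-integrable `]0, +oo[ (EFin \o gamma_integrand p).
Proof.
move=> p0; have [C C0 hC] := gamma_integrand_le p0.
apply: (@le_integrable _ _ _ mu _ _ _ (EFin \o (fun t => C * expR (- (t / 2))))) => //.
- by apply/measurable_EFinP; exact: measurable_gamma_integrand.
- move=> t; rewrite /= in_itv/= andbT => t0.
  by rewrite lee_fin !ger0_norm ?gamma_integrand_ge0 ?hC ?mulr_ge0 ?expR_ge0 ?ltW.
- have := integrableZl _ C integrable_expR_half; exact.
Qed.

Lemma Gamma_integral p : Gamma (p + 1) = \int[mu]_(t in `]0, +oo[) gamma_integrand p t.
Proof. by rewrite /Gamma addrK. Qed.

Lemma le_ln1B (y : R) : 0 < y -> 1 - y^-1 <= ln y.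
Proof.
move=> y0; have : ln (1 + (y^-1 - 1)) <= y^-1 - 1.
  by apply: le_ln1Dx; rewrite ltrDr invr_gt0.
by rewrite addrC subrK lnV ?posrE//; lra.
Qed.

Lemma powR_ge1Dln (y x : R) : 0 < y -> 1 + x * ln y <= y `^ x.
Proof. by move=> y0; rewrite /powR gt_eqF// expR_ge1Dx. Qed.

(** Integration by parts.  The derivative of t^s exp(-t) changes sign, whereas
    nonnegative integrands have no convergence problem on a half-line;
    adding a multiple of exp(-t/2), whose integral is known, makes it nonnegative. *)
Lemma GammaS s : 1 <= s -> Gamma (s + 1) = s * Gamma s.
Proof.
move=> s1.
have s0 : 0 <= s by lra.
have s10 : 0 <= s - 1 by lra.
have [C C0 hC] := gamma_integrand_le s10.
pose F t : R := - gamma_integrand s t - 2 * (s * C) * expR (- (t / 2)).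
pose h t : R := gamma_integrand s t - s * gamma_integrand (s - 1) t +
                s * C * expR (- (t / 2)).
have dF (t : R) : 0 < t -> is_derive t 1 F (h t).
  move=> t0; have := is_derive_gamma_integrand s t0 => dg.
  apply: is_derive_eq.
  by rewrite /GRing.scale/= /h !mulr1; field.
have ih : \int[mu]_(t in `[0, +oo[) h t = s * C * 2.
  rewrite (@Rintegral_ge0_continuous_FTC2y _ _ F _ 0).
  - rewrite /F /gamma_integrand powR0 ?mul0r ?oppr0 ?expR0; lra.
  - move=> t t0; rewrite /h; have := hC t t0.
    rewrite -(ler_pM2l (lt_le_trans ltr01 s1)).
    by have := gamma_integrand_ge0 s t; lra.
  - move=> x; apply: cvgD; first apply: cvgB.
    + exact: continuous_gamma_integrand.
    + by apply: cvgMr; exact: continuous_gamma_integrand.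
    + apply: cvgMr; exact: (continuous_subspaceT continuous_expR_half).
  - rewrite -[X in _ --> X]subr0 -[X in _ --> X - _]oppr0; apply: cvgB.
      by apply: cvgN; exact: gamma_integrand_cvg0.
    rewrite -(mulr0 (2 * (s * C))); apply: cvgMr; exact: cvg_expR_half.
  - by move=> x x0; case: (dF x x0).
  - apply: cvgB; first by apply: cvgN; exact: gamma_integrand_cvg_right.
    by apply: cvgMr; apply: cvg_at_right_filter; exact: continuous_expR_half.
  - by move=> x; rewrite in_itv/= andbT => x0; rewrite derive1E; case: (dF x x0).
have I1 := integrable_gamma_integrand s0.
have I2 := Rintegrable_scale s (integrable_gamma_integrand s10) (measurable_itv _).
have I3 := Rintegrable_scale (s * C) integrable_expR_half (measurable_itv _).
have I12 := Rintegrable_sub I1 I2 (measurable_itv _).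
have : \int[mu]_(t in `]0, +oo[) h t = Gamma (s + 1) - s * Gamma s + s * C * 2.
  have -> : Gamma s = \int[mu]_(t in `]0, +oo[) gamma_integrand (s - 1) t.
    by rewrite -Gamma_integral subrK.
  rewrite /h RintegralD// RintegralB// RintegralZl//; last exact: integrable_gamma_integrand.
  by rewrite RintegralZl// Gamma_integral Rintegral_expR_half.
rewrite Rintegral_itv_obnd_cbnd; last exact: Rintegrable_add.
rewrite ih; lra.
Qed.

Lemma Gamma1 : Gamma 1 = 1 :> R.
Proof.
rewrite -{1}[1]add0r Gamma_integral.
rewrite Rintegral_itv_obnd_cbnd; last exact: integrable_gamma_integrand.
rewrite (@Rintegral_ge0_continuous_FTC2y _ _ (fun t => - gamma_integrand 0 t) _ 0).
- by rewrite /gamma_integrand powRr0 oppr0 expR0; lra.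
- by move=> x _; exact: gamma_integrand_ge0.
- exact: continuous_gamma_integrand.
- by rewrite -oppr0; apply: cvgN; exact: gamma_integrand_cvg0.
- move=> x x0; have dg := is_derive_gamma_integrand 0 x0.
  exact: ex_derive.
- by apply: cvgN; exact: gamma_integrand_cvg_right.
- move=> x; rewrite in_itv/= andbT => x0.
  have dg := is_derive_gamma_integrand 0 x0.
  by rewrite derive1E derive_val mul0r sub0r opprK.
Qed.

(** This and the next lemma are Jensen's inequality for the Gamma densities: the
    tangent line bound (t / p)^x >= 1 + x (1 - p / t) is integrated against
    t^p exp(-t), and p is the value for which the correction terms cancel. *)
Lemma le_Gamma_shift p x : 1 <= p -> 0 <= x ->
  p `^ x * Gamma (p + 1) <= Gamma (p + x + 1).
Proof.
move=> p1 x0; have p0 : 0 < p by lra.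
have I1 : mu.-integrable `]0, +oo[ (EFin \o gamma_integrand p).
  by apply: integrable_gamma_integrand; lra.
have I2 : mu.-integrable `]0, +oo[ (EFin \o gamma_integrand (p - 1)).
  by apply: integrable_gamma_integrand; lra.
have I3 : mu.-integrable `]0, +oo[ (EFin \o gamma_integrand (p + x)).
  by apply: integrable_gamma_integrand; lra.
pose h t := p `^ x * ((1 + x) * gamma_integrand p t - x * p * gamma_integrand (p - 1) t).
have Ih : mu.-integrable `]0, +oo[ (EFin \o h).
  apply: Rintegrable_scale => //; apply: Rintegrable_sub => //; exact: Rintegrable_scale.
have -> : p `^ x * Gamma (p + 1) = \int[mu]_(t in `]0, +oo[) h t.
  rewrite /h RintegralZl//; last by apply: Rintegrable_sub => //; exact: Rintegrable_scale.
  rewrite RintegralB//; [|exact: Rintegrable_scale..].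
  rewrite !RintegralZl// -!Gamma_integral subrK GammaS; last by [].
  ring.
rewrite Gamma_integral; apply: le_Rintegral => // t; rewrite /= in_itv/= andbT => t0.
have y0 : 0 < t / p by rewrite divr_gt0.
have : 1 + x * (1 - (t / p)^-1) <= (t / p) `^ x.
  by apply: le_trans (powR_ge1Dln x y0); rewrite lerD2l ler_wpM2l// le_ln1B.
rewrite -(ler_pM2l (mulr_gt0 (powR_gt0 x p0) (mulr_gt0 (powR_gt0 p t0) (expR_gt0 (- t))))).
move=> H; apply: le_trans (le_trans H _); last first.
  have E : p `^ x * (t / p) `^ x = t `^ x.
    by rewrite -powRM ?ltW// mulrCA divff ?gt_eqF// mulr1.
  rewrite le_eqVlt; apply/orP; left; apply/eqP.
  rewrite mulrAC E /gamma_integrand powRD ?(gt_eqF t0) ?implybT//; ring.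
rewrite le_eqVlt; apply/orP; left; apply/eqP.
rewrite /h /gamma_integrand powRB ?(gt_eqF t0) ?implybT// powRr1 ?ltW//.
by field; rewrite !gt_eqF.
Qed.

(** The bound (t / c)^(-x) >= 1 - x (t / c - 1) is integrated against
    t^(p + x) exp(-t), and c = p + x + 1 makes the correction terms cancel. *)
Lemma ge_Gamma_shift p x : 0 <= p -> 0 <= x ->
  Gamma (p + x + 1) <= (p + x + 1) `^ x * Gamma (p + 1).
Proof.
move=> p0 x0; set c := p + x + 1; have c0 : 0 < c by rewrite /c; lra.
have I1 : mu.-integrable `]0, +oo[ (EFin \o gamma_integrand p).
  by apply: integrable_gamma_integrand; lra.
have I2 : mu.-integrable `]0, +oo[ (EFin \o gamma_integrand (p + x)).
  by apply: integrable_gamma_integrand; lra.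
have I3 : mu.-integrable `]0, +oo[ (EFin \o gamma_integrand (p + x + 1)).
  by apply: integrable_gamma_integrand; lra.
pose h t := (1 + x) * gamma_integrand (p + x) t - x / c * gamma_integrand (p + x + 1) t.
have Ih : mu.-integrable `]0, +oo[ (EFin \o h).
  by apply: Rintegrable_sub => //; exact: Rintegrable_scale.
have -> : Gamma c = \int[mu]_(t in `]0, +oo[) h t.
  rewrite /h RintegralB//; [|exact: Rintegrable_scale..].
  rewrite !RintegralZl// -!Gamma_integral (GammaS (s := c)); last by rewrite /c; lra.
  by field; rewrite gt_eqF.
rewrite Gamma_integral -RintegralZl//; apply: le_Rintegral => //.
  exact: Rintegrable_scale.
move=> t; rewrite /= in_itv/= andbT => t0.
have y0 : 0 < t / c by rewrite divr_gt0.
have : 1 - x * (t / c - 1) <= (t / c) `^ (- x).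
  apply: le_trans (powR_ge1Dln (- x) y0).
  rewrite mulNr lerD2l lerN2 ler_wpM2l//.
  have := @le_ln1Dx _ (t / c - 1); rewrite (addrC 1) subrK; apply; lra.
rewrite -(ler_pM2l (mulr_gt0 (powR_gt0 (p + x) t0) (expR_gt0 (- t)))).
move=> H; apply: le_trans (le_trans H _).
  rewrite le_eqVlt; apply/orP; left; apply/eqP.
  rewrite /h /gamma_integrand (powRD (s := 1)) ?(gt_eqF t0) ?implybT// powRr1 ?ltW//.
  by field; rewrite !gt_eqF.
rewrite le_eqVlt; apply/orP; left; apply/eqP.
rewrite powRM ?invr_ge0 ?ltW// -powR_inv1 ?ltW// -powRrM mulN1r opprK.
rewrite /gamma_integrand powRD ?(gt_eqF t0) ?implybT// powRN.
by field; rewrite gt_eqF ?powR_gt0.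
Qed.

(** Only the part of the integral over [c, c + 1] is kept.  As c is free, this
    shows that Gamma grows faster than any exponential. *)
Lemma Gamma_ge p c : 0 <= p -> 0 < c -> c `^ p * expR (- c - 1) <= Gamma (p + 1).
Proof.
move=> p0 c0; rewrite Gamma_integral.
rewrite -lee_fin fineK; last first.
  by apply: integrable_fin_num => //; exact: integrable_gamma_integrand.
have sub : `[c, c + 1] `<=` `]0, +oo[%classic.
  by move=> t; rewrite /= !in_itv/= andbT => /andP[ct _]; exact: lt_le_trans ct.
apply: (@le_trans _ _ (\int[mu]_(t in `[c, (c + 1)%R]) (gamma_integrand p t)%:E)%E); last first.
  apply: ge0_subset_integral => //.
    by apply/measurable_EFinP; exact: measurable_gamma_integrand.
  by move=> t _; rewrite lee_fin gamma_integrand_ge0.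
apply: (@le_trans _ _ (\int[mu]_(t in `[c, (c + 1)%R]) ((c `^ p * expR (- c - 1))%R%:E))%E).
  rewrite integral_cst//= lebesgue_measure_itv/= lte_fin ltrDl ltr01 -EFinD.
  by rewrite (addrC c) addrK mule1.
apply: ge0_le_integral => //.
- by move=> t _; rewrite lee_fin mulr_ge0 ?powR_ge0 ?expR_ge0.
- by apply/measurable_EFinP; exact: measurable_gamma_integrand.
move=> t; rewrite /= in_itv/= => /andP[ct tc].
rewrite lee_fin ler_pM ?powR_ge0 ?expR_ge0//.
  by apply: ge0_ler_powR; rewrite ?nnegrE// ltW// (lt_le_trans c0).
by rewrite ler_expR; lra.
Qed.

Lemma Gamma_gt0 p : 0 <= p -> 0 < Gamma (p + 1).
Proof.
move=> p0; apply: lt_le_trans (Gamma_ge p0 ltr01).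
by rewrite mulr_gt0 ?powR_gt0 ?expR_gt0.
Qed.

End Gamma_function.

(** * Coefficients of the powers of 1 / (1 - z) *)

Section rising.
Context {R : realFieldType}.
Implicit Types (x y a : R) (n k : nat).

(** The coefficient of z^n in (1 - z)^(-x). *)
Definition rising n x : R := \prod_(i < n) ((x + i%:R) / i.+1%:R).

Lemma rising0 x : rising 0 x = 1.
Proof. by rewrite /rising big_ord0. Qed.

Lemma risingS n x : rising n.+1 x = rising n x * ((x + n%:R) / n.+1%:R).
Proof. by rewrite /rising big_ord_recr. Qed.

Lemma rising_rec n x : n.+1%:R * rising n.+1 x = (x + n%:R) * rising n x.
Proof. by rewrite risingS mulrCA (mulrC n.+1%:R) divfK ?pnatr_eq0// mulrC. Qed.

Lemma rising1 n : rising n 1 = 1.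
Proof. by elim: n => [|n IH]; rewrite ?rising0// risingS IH mul1r nat1r divff ?pnatr_eq0. Qed.

Lemma rising_ge0 n x : 0 <= x -> 0 <= rising n x.
Proof. by move=> x0; apply: prodr_ge0 => i _; rewrite divr_ge0// addr_ge0. Qed.

(** The coefficients of (1-z)^(-x) (1-z)^(-y).  The induction multiplies by n + 1 and
    splits x + y + n into (x + k) + (y + n - k). *)
Lemma rising_Vandermonde n x y :
  rising n (x + y) = \sum_(k < n.+1) rising k x * rising (n - k) y.
Proof.
elim: n => [|n IH]; first by rewrite big_ord1 !rising0 mulr1.
have n1 : n.+1%:R != 0 :> R by rewrite pnatr_eq0.
apply: (mulfI n1); rewrite rising_rec {}IH.
have -> : (x + y + n%:R) * (\sum_(k < n.+1) rising k x * rising (n - k) y) =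
    \sum_(k < n.+1) k.+1%:R * (rising k.+1 x * rising (n.+1 - k.+1) y) +
    \sum_(k < n.+1) (n.+1 - k)%:R * (rising k x * rising (n.+1 - k) y).
  rewrite mulr_sumr -big_split/=; apply: eq_bigr => k _.
  have kn : (k <= n)%N by rewrite -ltnS.
  rewrite subSS subSn//.
  have -> : k.+1%:R * (rising k.+1 x * rising (n - k) y) =
    (x + k%:R) * rising k x * rising (n - k) y by rewrite mulrA rising_rec.
  have -> : (n - k).+1%:R * (rising k x * rising (n - k).+1 y) =
    rising k x * ((y + (n%:R - k%:R)) * rising (n - k) y).
    by rewrite mulrCA rising_rec natrB.
  ring.
rewrite mulr_sumr [RHS](eq_bigr (fun k : 'I_n.+2 =>
   k%:R * (rising k x * rising (n.+1 - k) y) +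
   (n.+1 - k)%:R * (rising k x * rising (n.+1 - k) y))); last first.
  move=> k _; have kn : (k <= n.+1)%N by rewrite -ltnS.
  by rewrite -mulrDl natrB// addrC subrK.
rewrite [RHS]big_split/=; congr (_ + _).
  by rewrite [RHS]big_ord_recl mul0r add0r.
by rewrite [RHS]big_ord_recr/= subnn mul0r addr0.
Qed.

Lemma rising_step n x : rising n.+1 (x + 1) = rising n (x + 1) + rising n.+1 x.
Proof.
rewrite !rising_Vandermonde [LHS]big_ord_recr/= subnn rising0 mulr1; congr (_ + _).
by apply: eq_bigr => k _; rewrite !rising1.
Qed.

Lemma rising_homo m n x : 0 <= x -> (m <= n)%N -> rising m (x + 1) <= rising n (x + 1).
Proof.
move=> x0 /subnKC <-; elim: (n - m)%N => [|k IH]; first by rewrite addn0.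
by rewrite addnS rising_step (le_trans IH)// lerDl rising_ge0.
Qed.

(** These are the coefficients of (1-z)^a: apart from the constant one they are
    nonpositive, because only the first factor of the product is negative. *)
Lemma rising_opp_le0 n a : 0 <= a <= 1 -> rising n.+1 (- a) <= 0.
Proof.
case/andP=> a0 a1; elim: n => [|n IH].
  by rewrite risingS rising0 addr0 mul1r divr1 oppr_le0.
rewrite risingS mulr_le0_ge0// divr_ge0// -natr1 addrC.
by rewrite -addrA addr_ge0// subr_ge0.
Qed.

End rising.

(** * Renewal sequences *)

Section renewal.
Context {R : realFieldType}.
Variables (c r u : nat -> R) (mu : R) (N : nat).
Hypothesis mu_ge0 : 0 <= mu.
Hypothesis c_ge0 : forall k, 0 <= c k.
Hypothesis r_ge0 : forall k, 0 <= r k.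
Hypothesis r0 : r 0%N = 1.
Hypothesis rS : forall k, r k = r k.+1 + c k.+1.
Hypothesis uE : forall n, (n <= N)%N ->
  (1 + mu) * u n = r n + \sum_(k < n) c k.+1 * u (n - k.+1)%N.

Let mu1 : 0 < 1 + mu. Proof. by rewrite ltr_pwDl. Qed.

(** Thus r n is the sum of the c k over k > n: the probability that the first renewal
    occurs after time n. *)
Lemma renewal_tail n : r n + \sum_(k < n) c k.+1 = 1.
Proof.
elim: n => [|n IH]; first by rewrite big_ord0 addr0.
by rewrite big_ord_recr/= addrCA -rS addrC.
Qed.

Lemma renewal_ge0 n : (n <= N)%N -> 0 <= u n.
Proof.
elim/ltn_ind: n => n IH nN.
rewrite -(pmulr_rge0 _ mu1) uE// addr_ge0// sumr_ge0// => k _.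
by have kn := ltn_ord k; rewrite mulr_ge0// IH//; lia.
Qed.

Lemma renewal_le1 n : (n <= N)%N -> u n <= 1.
Proof.
elim/ltn_ind: n => n IH nN.
rewrite -(ler_pM2l mu1) uE// mulr1.
apply: (@le_trans _ _ 1); last by rewrite lerDl.
rewrite -[leRHS](renewal_tail n) lerD2l ler_sum// => k _.
by have kn := ltn_ord k; rewrite ler_piMr// IH//; lia.
Qed.

(** Condition on the first renewal.  The contribution c (n + 1) u 0 of a first renewal
    at time n + 1 is at most c (n + 1), which is part of the tail r n; the other terms
    compare by induction. *)
Lemma renewal_step n : (n < N)%N -> u n.+1 <= u n.
Proof.
elim/ltn_ind: n => n IH nN.
rewrite -(ler_pM2l mu1) !uE//; last exact: ltnW.
rewrite big_ord_recr/= subnn (rS n) -addrA lerD2l addrC lerD//.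
  by rewrite ler_piMr// renewal_le1.
apply: ler_sum => k _; rewrite ler_wpM2l//.
have kn := ltn_ord k.
have -> : (n.+1 - k.+1 = (n - k.+1).+1)%N by lia.
by apply: IH; lia.
Qed.

Lemma renewal_homo m n : (m <= n)%N -> (n <= N)%N -> u n <= u m.
Proof.
move=> /subnKC <-; elim: (n - m)%N => [|k IH]; first by rewrite addn0.
rewrite addnS => kN; apply: le_trans (renewal_step kN) (IH _); exact: ltnW.
Qed.

(** A process which survives until time n starts afresh at its first renewal
    after n. *)
Lemma renewal_supermul m n : (n + m <= N)%N -> u n * u m <= u (n + m)%N.
Proof.
elim/ltn_ind: n => n IH nN.
have nN' : (n <= N)%N by lia.
have um : 0 <= u m by apply: renewal_ge0; lia.
rewrite -(ler_pM2l mu1) mulrA !uE// big_split_ord/= mulrDl.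
(* No renewal at a time at most n: the survival up to n + m is then at least u m,
   whether or not the first renewal occurs before n + m. *)
have tl : r n * u m <= r (n + m)%N + \sum_(k < m) c (n + k).+1 * u (n + m - (n + k).+1)%N.
  have -> : r n = r (n + m)%N + \sum_(k < m) c (n + k).+1.
    elim: (m) => [|j IHj]; first by rewrite big_ord0 addr0 addn0.
    by rewrite big_ord_recr/= IHj addnS (rS (n + j)) addrAC addrA.
  rewrite mulrDl lerD//; first by rewrite ler_piMr// renewal_le1//; lia.
  rewrite mulr_suml; apply: ler_sum => k _; rewrite ler_wpM2l//.
  by have kn := ltn_ord k; apply: renewal_homo; lia.
apply: le_trans (lerD tl (lexx _)) _.
rewrite -addrA lerD2l addrC lerD2r mulr_suml; apply: ler_sum => k _.
have kn := ltn_ord k.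
rewrite -mulrA ler_wpM2l//.
have -> : (n + m - k.+1 = n - k.+1 + m)%N by lia.
by apply: IH; lia.
Qed.
End renewal.

(** * Dominated convergence of series *)

Section Tannery.
Context {R : realType}.
Implicit Types (f b : R ^nat).

Lemma is_cvg_series_dominated f b : (forall j, `|f j| <= b j) ->
  cvgn (series b) -> cvgn (series f).
Proof.
move=> fb cb; apply: normed_cvg; apply: (@series_le_cvg _ (fun j => `|f j|) b) => // j.
by apply: le_trans (fb j).
Qed.

Lemma series_tail_le f b J : (forall j, `|f j| <= b j) -> cvgn (series b) ->
  `|limn (series f) - series f J| <= limn (series b) - series b J.
Proof.
move=> fb cb; have cf := is_cvg_series_dominated fb cb.
have b0 j : 0 <= b j by exact: le_trans (fb j).
apply: (@ler_cvg_to _ \oo _ _ (fun n => `|series f n - series f J|)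
  (fun n => series b n - series b J)).
- suff h : series f n - series f J @[n --> \oo] --> limn (series f) - series f J.
    exact: cvg_norm h.
  by apply: cvgB; [exact: cf | exact: cvg_cst].
- by apply: cvgB; [exact: cb | exact: cvg_cst].
near=> n; have Jn : (J <= n)%N by near: n; exact: nbhs_infty_ge.
rewrite !sub_series_geq// (le_trans (ler_norm_sum _ _ _))//.
exact: ler_sum.
Unshelve. all: end_near. Qed.

Lemma cvg_series_Tannery (F : nat -> R ^nat) f b :
  (forall j, F n j @[n --> \oo] --> f j) ->
  (\forall n \near \oo, forall j, `|F n j| <= b j) -> cvgn (series b) ->
  limn (series (F n)) @[n --> \oo] --> limn (series f).
Proof.
move=> Ff Fb cb.
have fb j : `|f j| <= b j.
  apply: (@cvgr_to_le _ \oo _ _ (fun n => `|F n j|)); first by apply: cvg_norm; exact: Ff.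
  by near=> n; have := near Fb n; apply.
apply/cvgrPdist_lt => e e0.
have e3 : 0 < e / 3 by rewrite divr_gt0.
have [J _ HJ] := (iffLR (cvgrPdist_lt _ _) cb) _ e3.
have {HJ} bJ : limn (series b) - series b J < e / 3.
  by have := HJ J (leqnn _); apply: le_lt_trans; rewrite ler_norm.
have FJ : series (F n) J @[n --> \oo] --> series f J.
  rewrite /series/=; elim: J {bJ} => [|J IH].
    by rewrite big_geq//; under eq_fun do rewrite big_geq//; exact: cvg_cst.
  rewrite big_nat_recr//=; under eq_fun do rewrite big_nat_recr//=.
  by apply: cvgD; [exact: IH | exact: Ff].
near=> n.
have h1 : `|series f J - series (F n) J| < e / 3.
  by near: n; exact: (iffLR (cvgrPdist_lt _ _) FJ).
have h2 := series_tail_le J fb cb.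
have h3 : `|limn (series (F n)) - series (F n) J| <= limn (series b) - series b J.
  by apply: series_tail_le => //; near: n.
have -> : limn (series f) - limn (series (F n)) = (limn (series f) - series f J) +
  (series f J - series (F n) J) - (limn (series (F n)) - series (F n) J) by ring.
rewrite (le_lt_trans (ler_normB _ _))// -ltrBrDr (le_lt_trans (ler_normD _ _))//.
lra.
Unshelve. all: end_near. Qed.
End Tannery.

(** * The discrete Mittag-Leffler function *)

Section resolvent.
Context {R : realType}.
(* The expansion in powers of mu is only needed for indices up to N, and the
   domination at N implies it below N. *)
Variables (a mu : R) (N : nat) (b : R ^nat).
Hypothesis a01 : 0 <= a <= 1.
Hypothesis mu_ge0 : 0 <= mu.
Hypothesis cvg_b : cvgn (series b).
Hypothesis dom : forall j, mu ^+ j * rising N (j%:R * a + 1) <= b j.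

Definition resolvent_term n j : R := (- mu) ^+ j * rising n (j%:R * a + 1).
(** The coefficient of z^n in (1-z)^(a-1) / ((1-z)^a + mu), expanded in powers
    of mu. *)
Definition resolvent n : R := limn (series (resolvent_term n)).

Let a_ge0 : 0 <= a. Proof. by case/andP: a01. Qed.
Let ja_ge0 j : 0 <= j%:R * a. Proof. by rewrite mulr_ge0. Qed.

Lemma resolvent_cvg n : (n <= N)%N ->
  series (resolvent_term n) @ \oo --> resolvent n.
Proof.
move=> nN; apply: (is_cvg_series_dominated _ cvg_b) => j.
have h : 0 <= rising n (j%:R * a + 1) by apply: rising_ge0; rewrite addr_ge0.
rewrite normrM normrX normrN (ger0_norm mu_ge0) (ger0_norm h).
by rewrite (le_trans _ (dom j))// ler_wpM2l ?exprn_ge0// rising_homo.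
Qed.

(** Multiplication by (1-z)^a lowers the exponent of the j-th term to that of the
    (j-1)-st one.  The identity is exact on partial sums, and one passes to the
    limit. *)
Lemma resolvent_renewal n : (n <= N)%N ->
  (1 + mu) * resolvent n =
  rising n (1 - a) + \sum_(k < n) - rising k.+1 (- a) * resolvent (n - k.+1).
Proof.
move=> nN.
(* On the left, J terms; on the right, J.+1 terms without the first. *)
have partial J : - mu * series (resolvent_term n) J =
    \sum_(k < n.+1) rising k (- a) * (series (resolvent_term (n - k)) J.+1 - 1).
  have -> : - mu * series (resolvent_term n) J =
      \sum_(j < J) (- mu) ^+ j.+1 * rising n (j%:R * a + 1).
    rewrite /series/= big_mkord mulr_sumr; apply: eq_bigr => j _.
    by rewrite /resolvent_term mulrA -exprS.
  under [RHS]eq_bigr => k _.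
    rewrite /series/= big_mkord big_ord_recl {1}/resolvent_term expr0 mul1r mul0r add0r.
    rewrite rising1 addrC addKr mulr_sumr; over.
  rewrite exchange_big/=; apply: eq_bigr => j _.
  have -> : j%:R * a + 1 = - a + (j.+1%:R * a + 1) by rewrite -(natr1 j); ring.
  rewrite rising_Vandermonde mulr_sumr; apply: eq_bigr => k _.
  by rewrite /resolvent_term mulrCA.
have key : - mu * resolvent n =
    \sum_(k < n.+1) rising k (- a) * (resolvent (n - k) - 1).
  have L : - mu * series (resolvent_term n) J @[J --> \oo] --> - mu * resolvent n.
    by apply: cvgMr; exact: resolvent_cvg.
  move: L; rewrite (funext partial) => L.
  apply: (cvg_unique _ L) => //.
  apply: cvg_big => [|k _]; first exact: add_continuous.
   apply: cvgMr; apply: cvgB; last exact: cvg_cst.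
  by rewrite (cvg_shiftS (series (resolvent_term (n - k)))); apply: resolvent_cvg; lia.
move: key; rewrite big_ord_recl/= rising0 mul1r subn0 => key.
have -> : rising n (1 - a) = 1 + \sum_(k < n) rising k.+1 (- a).
  rewrite addrC rising_Vandermonde (eq_bigr (fun k : 'I_n.+1 => rising k (- a))).
    by rewrite big_ord_recl rising0.
  by move=> k _; rewrite rising1 mulr1.
have -> : (1 + mu) * resolvent n = resolvent n - (- mu * resolvent n) by ring.
rewrite key opprD opprB addrA addrCA subrr addr0 -addrA; congr (1 + _).
rewrite -sumrN -big_split/=; apply: eq_bigr => k _.
rewrite /bump/= add1n; ring.
Qed.

Let r n : R := rising n (1 - a).
Let c' k : R := if k is k'.+1 then - rising k (- a) else 0.

Let c'_ge0 k : 0 <= c' k.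
Proof. by case: k => [|k]//=; rewrite oppr_ge0 rising_opp_le0. Qed.

Let r_ge0 n : 0 <= r n.
Proof. by apply: rising_ge0; case/andP: a01; rewrite subr_ge0. Qed.

Let r0 : r 0 = 1. Proof. exact: rising0. Qed.

Let rS n : r n = r n.+1 + c' n.+1.
Proof. by rewrite /r/= (addrC 1) rising_step addrK. Qed.

Let uE n : (n <= N)%N ->
  (1 + mu) * resolvent n = r n + \sum_(k < n) c' k.+1 * resolvent (n - k.+1).
Proof. exact: resolvent_renewal. Qed.

Lemma resolvent_ge0 n : (n <= N)%N -> 0 <= resolvent n.
Proof. exact: (renewal_ge0 mu_ge0 c'_ge0 r_ge0 uE). Qed.

Lemma resolvent_le1 n : (n <= N)%N -> resolvent n <= 1.
Proof. exact: (renewal_le1 mu_ge0 c'_ge0 r0 rS uE). Qed.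

Lemma resolvent_homo m n : (m <= n)%N -> (n <= N)%N -> resolvent n <= resolvent m.
Proof. exact: (renewal_homo mu_ge0 c'_ge0 r0 rS uE). Qed.

Lemma resolvent_supermul m n : (n + m <= N)%N ->
  resolvent n * resolvent m <= resolvent (n + m).
Proof. exact: (renewal_supermul mu_ge0 c'_ge0 r_ge0 r0 rS uE). Qed.
End resolvent.

(** * Positivity and monotonicity of the Mittag-Leffler function *)

Section Mittag_Leffler.
Context {R : realType}.
Implicit Types (x t z a A : R) (n m N j : nat).

Lemma Gamma_nat n : Gamma (n%:R + 1) = n`!%:R :> R.
Proof.
elim: n => [|n IH]; first by rewrite add0r Gamma1.
by rewrite (@GammaS _ n.+1%:R) -?natr1 ?lerDr// IH natr1 factS natrM.
Qed.

Lemma Gamma_rising n x : 0 <= x ->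
  Gamma (n%:R + x + 1) = rising n (x + 1) * Gamma (x + 1) * n`!%:R.
Proof.
move=> x0; elim: n => [|n IH]; first by rewrite add0r rising0 mul1r mulr1.
have -> : n.+1%:R + x + 1 = (n%:R + x + 1) + 1 by rewrite -natr1; ring.
rewrite (@GammaS _ (n%:R + x + 1)) ?lerDr ?addr_ge0// IH factS natrM.
have -> : n%:R + x + 1 = x + 1 + n%:R by ring.
by rewrite !mulrA -rising_rec; ring.
Qed.

Lemma rising_lower n x : (0 < n)%N -> 0 <= x ->
  n%:R `^ x / Gamma (x + 1) <= rising n (x + 1).
Proof.
move=> n0 x0; rewrite ler_pdivrMr ?Gamma_gt0//.
have fn : 0 < n`!%:R :> R by rewrite ltr0n fact_gt0.
by rewrite -(ler_pM2r fn) -Gamma_rising// -Gamma_nat le_Gamma_shift// ler1n.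
Qed.

Lemma rising_upper n x : 0 <= x ->
  rising n (x + 1) <= (n%:R + x + 1) `^ x / Gamma (x + 1).
Proof.
move=> x0; rewrite ler_pdivlMr ?Gamma_gt0//.
have fn : 0 < n`!%:R :> R by rewrite ltr0n fact_gt0.
by rewrite -(ler_pM2r fn) -Gamma_rising// -Gamma_nat ge_Gamma_shift.
Qed.

Lemma cvg_powRl t x : 0 < t -> s `^ x @[s --> t] --> t `^ x.
Proof.
move=> t0; suff : {for t, continuous ((@powR R)^~ x)} by [].
apply: differentiable_continuous; apply/derivable1_diffP.
by apply: derivable_powR; rewrite in_itv/= andbT.
Qed.

Lemma cvg_invn : (n%:R^-1 : R) @[n --> \oo] --> 0.
Proof.
have pos : \forall n \near \oo, 0 < (n%:R : R).
  by near=> n; rewrite ltr0n; near: n; exact: nbhs_infty_gt.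
exact: (iffRL (gtr0_cvgV0 pos) cvgr_idn).
Unshelve. all: end_near. Qed.

(** Euler's limit formula for the Gamma function. *)
Lemma rising_cvg x : 0 <= x ->
  rising n (x + 1) / n%:R `^ x @[n --> \oo] --> (Gamma (x + 1))^-1.
Proof.
move=> x0.
apply: (@squeeze_cvgr _ \oo _ _ (fun=> (Gamma (x + 1))^-1)
  (fun n => (1 + (x + 1) / n%:R) `^ x / Gamma (x + 1))).
- near=> n.
  have n0 : (0 < n)%N by near: n; exact: nbhs_infty_gt.
  have n0' : 0 < n%:R :> R by rewrite ltr0n.
  have nx0 : 0 < n%:R `^ x by rewrite powR_gt0.
  apply/andP; split.
    by rewrite ler_pdivlMr// mulrC rising_lower.
  rewrite ler_pdivrMr// mulrAC -powRM//; last by rewrite addr_ge0// divr_ge0// addr_ge0.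
  rewrite mulrDl mul1r divfK ?gt_eqF// addrA; exact: rising_upper.
- exact: cvg_cst.
- have h : (1 + (x + 1) / n%:R) `^ x @[n --> \oo] --> 1 `^ x.
    apply: (@cvg_comp _ _ _ (fun n => 1 + (x + 1) / n%:R) ((@powR R)^~ x) _ (nbhs (1 : R))).
      suff : 1 + (x + 1) / n%:R @[n --> \oo] --> 1 + (x + 1) * 0 by rewrite mulr0 addr0.
      by apply: cvgD; [exact: cvg_cst | apply: cvgMr; exact: cvg_invn].
    exact: cvg_powRl.
  suff : (1 + (x + 1) / n%:R) `^ x / Gamma (x + 1) @[n --> \oo] -->
    1 `^ x / Gamma (x + 1) by rewrite powR1 mul1r.
  exact: cvgMl.
Unshelve. all: end_near. Qed.

(** The upper bound ((n + x + 1) / n)^x / Gamma (x + 1) is combined with Gamma_ge at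
    c = A (n + x + 1) / n <= A + x + 1.  The result is uniform in n >= A and
    decreases geometrically in x, with a ratio that A makes as small as desired. *)
Lemma rising_dominated A n x : 0 < A -> A <= n%:R -> 0 <= x ->
  rising n (x + 1) / n%:R `^ x <= expR (A + 2) * (expR 1 / A) `^ x.
Proof.
move=> A0 An x0; have n0 : 0 < n%:R :> R by exact: lt_le_trans An.
have nx0 : 0 < n%:R `^ x by rewrite powR_gt0.
rewrite ler_pdivrMr// (le_trans (rising_upper _ x0))//.
rewrite ler_pdivrMr ?Gamma_gt0//.
pose c := A * ((n%:R + x + 1) / n%:R).
have q0 : 0 < (n%:R + x + 1) / n%:R by rewrite divr_gt0//; lra.
have c0 : 0 < c by rewrite mulr_gt0.
apply: le_trans (ler_wpM2l _ (Gamma_ge x0 c0)); last first.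
  by rewrite !mulr_ge0 ?expR_ge0 ?powR_ge0.
have cE : c <= A + x + 1.
  rewrite /c -addrA mulrDl divff ?gt_eqF// mulrDr mulr1 -addrA lerD2l mulrCA ler_piMr ?addr_ge0//.
  by rewrite ler_pdivrMr// mul1r.
have E1 : (n%:R + x + 1) `^ x = n%:R `^ x * ((n%:R + x + 1) / n%:R) `^ x.
  by rewrite -powRM ?(ltW n0) ?(ltW q0)// mulrCA divff ?mulr1 ?gt_eqF.
have E2 : (expR 1 / A) `^ x * c `^ x = expR x * ((n%:R + x + 1) / n%:R) `^ x.
  rewrite -powRM ?ltW// ?divr_gt0 ?expR_gt0// /c mulrA divfK ?gt_eqF//.
  by rewrite powRM ?expR_ge0 ?(ltW q0)// -expRM mul1r.
rewrite E1.
have -> : expR (A + 2) * (expR 1 / A) `^ x * n%:R `^ x * (c `^ x * expR (- c - 1)) =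
  n%:R `^ x * (expR (A + 2) * expR (- c - 1)) * ((expR 1 / A) `^ x * c `^ x) by ring.
rewrite E2 -mulrA ler_pM2l// mulrA ler_peMl ?powR_ge0// -!expRD -[leLHS]expR0 ler_expR.
lra.
Qed.

(** The discrete Mittag-Leffler function, on the grid of mesh 1 / N, converges to the
    continuous one.  The dominating series is returned as well, since it is what makes
    the renewal inequalities applicable to the terms of the sequence. *)
Lemma cvg_resolvent a t (nN : nat -> nat) : 0 < a -> 0 < t ->
  (nN N)%:R / N%:R @[N --> \oo] --> t ->
  exists b : R ^nat, [/\ cvgn (series b),
   (\forall N \near \oo, forall j, (N%:R `^ (- a)) ^+ j * rising (nN N) (j%:R * a + 1) <= b j) &
  resolvent a (N%:R `^ (- a)) (nN N) @[N --> \oo] --> mittag_leffler a (- (t `^ a))].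
Proof.
move=> a0 t0 nt.
(* This value of A makes the j-th term of the dominating series a multiple of
   2 ^- j, as (2 t expR 1 / A) `^ a = 1 / 2. *)
pose A := 2 * t * expR 1 * 2 `^ (a^-1).
have A0 : 0 < A by rewrite !mulr_gt0 ?expR_gt0 ?powR_gt0.
pose b j : R := expR (A + 2) * 2^-1 ^+ j.
have cb : cvgn (series b).
  by apply: is_cvg_geometric_series; rewrite ger0_norm ?invr_ge0// invf_lt1// ltr1n.
have ja0 j : 0 <= j%:R * a by rewrite mulr_ge0// ltW.
have nNy : (nN N)%:R @[N --> \oo] --> (+oo : set_system R).
  apply/cvgryPge => M; near=> N.
  have N0 : 0 < N%:R :> R by rewrite ltr0n; near: N; exact: nbhs_infty_gt.
  have h : t / 2 <= (nN N)%:R / N%:R.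
    by near: N; apply: (cvgr_ge _ nt); lra.
  have h2 : 2 * M / t <= N%:R.
    near: N; exact: (iffLR (cvgryPge _) (@cvgr_idn R)).
  rewrite ler_pdivlMr// in h; rewrite ler_pdivrMr// in h2.
  by apply: le_trans h; lra.
have E N j : (0 < N)%N -> (0 < nN N)%N -> (N%:R `^ (- a)) ^+ j * rising (nN N) (j%:R * a + 1) =
    ((nN N)%:R / N%:R) `^ (j%:R * a) * (rising (nN N) (j%:R * a + 1) / (nN N)%:R `^ (j%:R * a)).
  move=> N0 n0.
  rewrite powRM ?invr_ge0// -powR_inv1// -powR_mulrn ?powR_ge0// -!powRrM.
  have -> : - a * j%:R = -1 * (j%:R * a) by ring.
  rewrite mulrA [_ * rising _ _ ]mulrC mulrA.
  have : ((nN N)%:R `^ (j%:R * a) : R) != 0 by rewrite gt_eqF// powR_gt0 ?ltr0n.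
  by move=> h; field.
have near0 : \forall N \near \oo, [/\ (0 < N)%N, (0 < nN N)%N, A <= (nN N)%:R & (nN N)%:R / N%:R <= 2 * t].
  near=> N.
  have An : A <= (nN N)%:R by near: N; exact: (iffLR (cvgryPge _) nNy).
  split => //.
  - by near: N; exact: nbhs_infty_gt.
  - by rewrite -(ltr0n R); exact: lt_le_trans An.
  - by near: N; apply: (cvgr_le _ nt); lra.
have dom : \forall N \near \oo, forall j, (N%:R `^ (- a)) ^+ j * rising (nN N) (j%:R * a + 1) <= b j.
  near=> N => j.
  have [N0 n0 An n2] :
      [/\ (0 < N)%N, (0 < nN N)%N, A <= (nN N)%:R & (nN N)%:R / N%:R <= 2 * t].
    by near: N; exact: near0.
  rewrite E//.
  have h1 := rising_dominated A0 An (ja0 j).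
  have h2 : ((nN N)%:R / N%:R) `^ (j%:R * a) <= (2 * t) `^ (j%:R * a).
    by apply: ge0_ler_powR; rewrite ?nnegrE ?divr_ge0// mulr_ge0// ltW.
  apply: le_trans (ler_pM _ _ h2 h1) _.
  - by rewrite powR_ge0.
  - by rewrite divr_ge0 ?powR_ge0// rising_ge0// addr_ge0.
  rewrite /b mulrCA ler_pM2l ?expR_gt0// -powRM ?divr_ge0 ?expR_ge0 ?(ltW A0) ?mulr_ge0 ?(ltW t0)//.
  have -> : 2 * t * (expR 1 / A) = 2 `^ (- a^-1).
    rewrite powRN /A; field.
    by rewrite !gt_eqF ?expR_gt0 ?powR_gt0.
  rewrite -powRrM; have -> : - a^-1 * (j%:R * a) = -1 * j%:R by field; rewrite gt_eqF.
  by rewrite powRrM powR_inv1// powR_mulrn// invr_ge0.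
exists b; split => //.
have -> : mittag_leffler a (- (t `^ a)) =
    limn (series (fun j => (-1) ^+ j * (t `^ (j%:R * a) / Gamma (j%:R * a + 1)))).
  rewrite /mittag_leffler; congr (limn (series _)); apply/funext => j.
  by rewrite (exprNn (t `^ a)) -mulrA (mulrC j%:R) powRrM powR_mulrn ?powR_ge0.
apply: (@cvg_series_Tannery _ _ _ b) => // [j|]; last first.
  near=> N => j; rewrite /resolvent_term normrM normrX normrN (ger0_norm (powR_ge0 _ _)).
  by rewrite ger0_norm ?rising_ge0 ?addr_ge0//; move: j; near: N.
suff H : (-1) ^+ j * (((nN N)%:R / N%:R) `^ (j%:R * a) *
   (rising (nN N) (j%:R * a + 1) / (nN N)%:R `^ (j%:R * a))) @[N --> \oo] -->
   (-1) ^+ j * (t `^ (j%:R * a) / Gamma (j%:R * a + 1)).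
  apply: cvg_trans H; apply: near_eq_cvg; near=> N.
  have [N0 n0 An n2] : [/\ (0 < N)%N, (0 < nN N)%N, A <= (nN N)%:R & (nN N)%:R / N%:R <= 2 * t].
    by near: N; exact: near0.
  by rewrite -E// mulrA -exprMn mulN1r.
apply: cvgMr; apply: cvgM.
  apply: (@cvg_comp _ _ _ (fun N => (nN N)%:R / N%:R) ((@powR R)^~ (j%:R * a)) _ (nbhs t)).
    exact: nt.
  exact: cvg_powRl.
apply: (@cvg_comp _ _ _ nN (fun n => rising n (j%:R * a + 1) / n%:R `^ (j%:R * a)) _ \oo); last exact: rising_cvg.
apply/cvgnyPge => M; near=> N; rewrite -(ler_nat R); near: N.
exact: (iffLR (cvgryPge _) nNy).
Unshelve. all: end_near. Qed.

Lemma truncn_cvg t : 0 < t -> (Num.truncn (t * N%:R))%:R / N%:R @[N --> \oo] --> t.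
Proof.
move=> t0.
apply: (@squeeze_cvgr _ \oo _ _ (fun N => t - N%:R^-1) (fun=> t)).
- near=> N.
  have N0 : 0 < N%:R :> R by rewrite ltr0n; near: N; exact: nbhs_infty_gt.
  have tN : 0 <= t * N%:R by rewrite mulr_ge0// ltW.
  have /andP[h1 h2] := truncn_itv tN.
  rewrite ler_pdivrMr// h1 ler_pdivlMr// mulrBl mulVf ?gt_eqF// andbT lerBlDr.
  by rewrite natr1 ltW.
- suff : t - n%:R^-1 @[n --> \oo] --> t - 0 by rewrite subr0.
  by apply: cvgB; [exact: cvg_cst | exact: cvg_invn].
- exact: cvg_cst.
Unshelve. all: end_near. Qed.

Lemma mittag_leffler0 a : mittag_leffler a 0 = 1.
Proof.
rewrite /mittag_leffler; apply: (@cvg_lim _ (@Rhausdorff R)); rewrite -cvg_shiftS.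
rewrite (_ : (fun n => _) = fun=> 1); first exact: cvg_cst.
apply/funext => n; rewrite /series/= big_nat_recl// expr0 mul0r add0r Gamma1 divr1.
by rewrite big1 ?addr0// => i _; rewrite exprS mul0r mul0r.
Qed.

Section positivity.
Variable a : R.
Hypothesis a01 : 0 < a <= 1.
Let a0 : 0 < a. Proof. by case/andP: a01. Qed.
Let a01' : 0 <= a <= 1. Proof. by case/andP: a01 => /ltW -> ->. Qed.

(* In this time scale the functional inequality takes the form
   K t * K t <= K (2 * t). *)
Let K t : R := mittag_leffler a (- (t `^ a)).

Let K_limit t : 0 < t ->
  exists b : R ^nat, [/\ cvgn (series b),
   (\forall N \near \oo, forall j, (N%:R `^ (- a)) ^+ j *
      rising (Num.truncn (t * N%:R)) (j%:R * a + 1) <= b j) &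
   resolvent a (N%:R `^ (- a)) (Num.truncn (t * N%:R)) @[N --> \oo] --> K t].
Proof. by move=> t0; exact: (cvg_resolvent a0 t0 (truncn_cvg t0)). Qed.

Let K_ge0_le1 t : 0 < t -> 0 <= K t <= 1.
Proof.
move=> t0; have [b [cb dom lim]] := K_limit t0.
apply/andP; split; [apply: (cvgr_to_ge lim) | apply: (cvgr_to_le lim)]; near=> N.
- by apply: (resolvent_ge0 a01' (powR_ge0 _ _) cb (N := Num.truncn (t * N%:R))) => //; near: N.
- by apply: (resolvent_le1 a01' (powR_ge0 _ _) cb (N := Num.truncn (t * N%:R))) => //; near: N.
Unshelve. all: end_near. Qed.

Let K_homo s t : 0 <= s -> s <= t -> K t <= K s.
Proof.
rewrite le_eqVlt => /predU1P[<-|s0] st.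
  have K0 : K 0 = 1 by rewrite /K powR0 ?gt_eqF// oppr0 mittag_leffler0.
  move: st; rewrite le_eqVlt => /predU1P[<-//|t0].
  by rewrite K0; case/andP: (K_ge0_le1 t0).
have t0 := lt_le_trans s0 st.
have [b [cb dom limt]] := K_limit t0.
have [_ [_ _ lims]] := K_limit s0.
apply: (ler_cvg_to limt lims); near=> N.
apply: (resolvent_homo a01' (powR_ge0 _ _) cb (N := Num.truncn (t * N%:R))) => //.
  by near: N.
by apply: le_truncn; rewrite ler_wpM2r.
Unshelve. all: end_near. Qed.

Let K_double t : 0 < t -> K t * K t <= K (2 * t).
Proof.
move=> t0; have [_ [_ _ lim1]] := K_limit t0.
have t20 : 0 < 2 * t by rewrite mulr_gt0.
have nt : (Num.truncn (t * N%:R) + Num.truncn (t * N%:R))%:R / N%:R @[N --> \oo] --> 2 * t.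
  have -> : 2 * t = t + t by ring.
  under eq_fun do rewrite natrD mulrDl.
  by apply: cvgD; exact: truncn_cvg.
have [b [cb dom lim2]] := cvg_resolvent a0 t20 nt.
apply: (ler_cvg_to (cvgM lim1 lim1) lim2); near=> N.
apply: (resolvent_supermul a01' (powR_ge0 _ _) cb _ (leqnn _)).
by near: N.
Unshelve. all: end_near. Qed.

Let K_gt0_somewhere : exists2 s, 0 < s & 0 < K s.
Proof.
(* Continuity of the series at 0: c is such that Gamma_ge bounds the coefficient
   of order j by a multiple of 2 ^- j. *)
pose c : R := 2 `^ a^-1; have c0 : 0 < c by rewrite powR_gt0.
have lim : mittag_leffler a (- n.+1%:R^-1) @[n --> \oo] --> mittag_leffler a 0.
  pose b j : R := expR (c + 1) * 2^-1 ^+ j.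
  have cb : cvgn (series b).
    by apply: is_cvg_geometric_series; rewrite ger0_norm ?invr_ge0// invf_lt1// ltr1n.
  apply: (@cvg_series_Tannery _ _ _ b) => // [j|].
    apply: cvgMl; case: j => [|j].
      by rewrite expr0; under eq_fun do rewrite expr0; exact: cvg_cst.
    apply: (@cvg_comp _ _ _ (fun n => - n.+1%:R^-1 : R) (fun x => x ^+ j.+1) _ (nbhs (0 : R))).
      by rewrite -oppr0; apply: cvgN; exact: cvg_harmonic.
    exact: exprn_continuous.
  near=> n => j; have ja0 : 0 <= j%:R * a by rewrite mulr_ge0// ltW.
  have Gj := Gamma_gt0 ja0; have Gj' : 0 <= (Gamma (j%:R * a + 1))^-1 by rewrite invr_ge0 ltW.
  rewrite normrM normrX normrN (ger0_norm Gj') ger0_norm ?invr_ge0// ler_pdivrMr//.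
  apply: (@le_trans _ _ 1); first by rewrite exprn_ile1// invf_le1// ler1n.
  have bj : 0 <= b j by rewrite mulr_ge0 ?expR_ge0// exprn_ge0// invr_ge0.
  apply: le_trans (ler_wpM2l bj (Gamma_ge ja0 c0)).
  have -> : c `^ (j%:R * a) = 2 ^+ j.
    by rewrite /c -powRrM mulrCA mulVf ?gt_eqF// mulr1 powR_mulrn.
  have E2 : 2^-1 ^+ j * 2 ^+ j = 1 :> R by rewrite -exprMn mulVf// expr1n.
  rewrite /b mulrA -(mulrA (expR _)) E2 mulr1 -expRD.
  by rewrite -[leLHS]expR0 ler_expR; lra.
have [n _ /(_ n (leqnn n))] : \forall n \near \oo, 0 < mittag_leffler a (- n.+1%:R^-1).
  by apply: (cvgr_gt _ lim); rewrite mittag_leffler0.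
move=> h; exists (n.+1%:R^-1 `^ a^-1); first by rewrite powR_gt0 ?invr_gt0.
by rewrite /K -powRrM mulVf ?gt_eqF// powRr1.
Unshelve. all: end_near. Qed.

Let K_gt0 t : 0 < t -> 0 < K t.
Proof.
move=> t0; have [s s0 Ks] := K_gt0_somewhere.
have H k : 0 < K (2 ^+ k * s).
  elim: k => [|k IH]; first by rewrite expr0 mul1r.
  rewrite exprS -mulrA; apply: lt_le_trans (K_double _); last by rewrite mulr_gt0 ?exprn_gt0.
  by rewrite mulr_gt0.
pose k := Num.truncn (t / s).
apply: lt_le_trans (H k.+1) (K_homo (ltW t0) _).
rewrite -ler_pdivrMr//.
have := truncnS_gt (t / s); rewrite -/k => /ltW /le_trans; apply.
by rewrite -natrX ler_nat ltnW// ltn_expl.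
Qed.

Lemma mittag_leffler_homo (x y : R) : 0 <= x -> x <= y ->
  mittag_leffler a (- y) <= mittag_leffler a (- x).
Proof.
move=> x0 xy; have root z : 0 <= z -> z = (z `^ a^-1) `^ a.
  by move=> z0; rewrite -powRrM mulVf ?gt_eqF// powRr1.
rewrite (root x x0) (root y (le_trans x0 xy)); apply: K_homo; first exact: powR_ge0.
by apply: ge0_ler_powR; rewrite ?nnegrE ?invr_ge0 ?(ltW a0)// (le_trans x0).
Qed.

Lemma mittag_leffler_gt0 (x : R) : 0 <= x -> 0 < mittag_leffler a (- x).
Proof.
rewrite le_eqVlt => /predU1P[<-|x0]; first by rewrite oppr0 mittag_leffler0.
have -> : x = (x `^ a^-1) `^ a by rewrite -powRrM mulVf ?gt_eqF// powRr1// ltW.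
by apply: K_gt0; rewrite powR_gt0.
Qed.
End positivity.
End Mittag_Leffler.

(** * Integration against a nondecreasing weight *)

Lemma sum_ltn n q : (\sum_(k < n) (k < q) = minn n q)%N.
Proof.
elim: n => [|m IH]; first by rewrite big_ord0 min0n.
by rewrite big_ord_recr/= IH; lia.
Qed.

Section monotone_weight.
Context {R : realType}.
Local Notation mu := (@lebesgue_measure R).
Variables (t : R) (y phi : R -> R).
Hypothesis y_int : mu.-integrable `[0, t] (EFin \o y).
Hypothesis phi_homo : {homo phi : r s / r <= s}.
Hypothesis tails : forall s, 0 <= s <= t -> 0 <= \int[mu]_(r in `[s, t]) y r.

Let superlevel (c : R) : set R := `[0, t] `&` [set s | c <= phi s].

(** The superlevel set is an interval with right end t, closed or open on the left,
    and its left end does not matter for the integral. *)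
Lemma superlevel_integral_ge0 c : 0 <= \int[mu]_(r in superlevel c) y r.
Proof.
set U := superlevel c.
have [->|/set0P U0] := eqVneq U set0; first by rewrite Rintegral_set0.
have lbU : has_lbound U.
  by exists 0 => s [] /=; rewrite in_itv/= => /andP[].
pose i := inf U.
have i0 : 0 <= i.
  by apply: lb_le_inf => // s [] /=; rewrite in_itv/= => /andP[].
have it : i <= t.
  have [s Us] := U0; apply: (@le_trans _ _ s); first exact: ge_inf.
  by case: Us => /=; rewrite in_itv/= => /andP[].
have up s : i < s -> s <= t -> U s.
  move=> is_ st; have [r Ur rs] := inf_lt U0 is_.
  split; first by rewrite /= in_itv/= st (le_trans i0) ?ltW.
  by case: Ur => _ /= /le_trans; apply; rewrite phi_homo// ltW.
have tail : 0 <= \int[mu]_(r in `[i, t]) y r by apply: tails; rewrite i0.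
have [Ui|nUi] := pselect (U i).
  rewrite (_ : U = `[i, t]%classic)//; apply/seteqP; split => s.
    by move=> Us; rewrite /= in_itv/= ge_inf//=; case: Us => /=; rewrite in_itv/= => /andP[].
  rewrite /= in_itv/= le_eqVlt => /andP[/predU1P[<-//|is_] st]; exact: up.
rewrite (_ : U = `]i, t]%classic).
  rewrite Rintegral_itv_obnd_cbnd//.
  apply: (integrableS _ _ _ y_int) => // s.
  by rewrite /= !in_itv/= => /andP[is_ ->]; rewrite (le_trans i0) ?ltW.
apply/seteqP; split => s.
  move=> Us; rewrite /= in_itv/= (inf_lb_strict lbU nUi Us)/=.
  by case: Us => /=; rewrite in_itv/= => /andP[].
by rewrite /= in_itv/= => /andP[]; exact: up.
Qed.

Hypothesis phi01 : forall s, 0 <= phi s <= 1.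

Let measurable_superlevel c : measurable [set s | c <= phi s].
Proof.
rewrite [X in measurable X](_ : _ = phi @^-1` `[c, +oo[).
  rewrite -[X in measurable X]setTI.
  by apply: (nondecreasing_measurable measurableT phi_homo).
by apply/seteqP; split => s /=; rewrite in_itv/= andbT.
Qed.

Lemma integrable_weight : mu.-integrable `[0, t] (EFin \o (fun s => phi s * y s)).
Proof.
apply: (le_integrable _ _ _ y_int) => //=.
  apply/measurable_EFinP; apply: measurable_funM.
    apply: measurable_funTS; exact: (nondecreasing_measurable measurableT phi_homo).
  by apply/measurable_EFinP; exact: (measurable_int mu).
move=> s _; have /andP[h0 h1] := phi01 s.
by rewrite lee_fin normrM (ger0_norm h0) ler_piMl.
Qed.

(* n times the weight is approximated within 1 by the number of the levels
   1, ..., n that it reaches. *)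
Let level (n k : nat) : set R := [set s | k.+1%:R <= n%:R * phi s].

Let level_integrable n k : mu.-integrable `[0, t] (EFin \o (y \_ (level n k))).
Proof.
have ml : measurable (level n k).
  have [->|n0] := posnP n.
    rewrite (_ : level 0 k = set0)//; apply/seteqP; split => s //.
    by rewrite /level/= mul0r leNgt ltr0n.
  have -> : level n k = [set s | k.+1%:R / n%:R <= phi s].
    by apply/seteqP; split => s; rewrite /level/= ler_pdivrMr ?ltr0n// mulrC.
  exact: measurable_superlevel.
have -> : EFin \o (y \_ (level n k)) = ((EFin \o y) \_ (level n k))%E.
  by rewrite restrict_EFin.
apply: (iffLR (integrable_restrict mu ml _ _)) => //.
by apply: (integrableS _ _ _ y_int) => //; exact: measurableI.
Qed.

Let staircase n m s : R := \sum_(k < m) (y \_ (level n k)) s.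

Let staircase_ge0 n m : (0 < n)%N ->
  mu.-integrable `[0, t] (EFin \o staircase n m) /\
  0 <= \int[mu]_(s in `[0, t]) staircase n m s.
Proof.
move=> n0; elim: m => [|m [IH1 IH2]].
  have -> : staircase n 0 = cst 0 by apply/funext => s; rewrite /staircase big_ord0.
  split; first exact: integrable0.
  exact: Rintegral_ge0.
have -> : staircase n m.+1 = (fun s => staircase n m s + (y \_ (level n m)) s).
  by apply/funext => s; rewrite /staircase big_ord_recr.
split; first by apply: Rintegrable_add.
rewrite RintegralD// addr_ge0// -Rintegral_mkcondr.
have -> : level n m = [set s | m.+1%:R / n%:R <= phi s].
  by apply/seteqP; split => s; rewrite /level/= ler_pdivrMr ?ltr0n// mulrC.
exact: superlevel_integral_ge0.
Qed.

Let count_levels n s : `|(\sum_(k < n) (k.+1%:R <= n%:R * phi s)%R)%N%:R - n%:R * phi s| <= 1.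
Proof.
have /andP[h0 h1] := phi01 s; set z := n%:R * phi s.
have z0 : 0 <= z by rewrite mulr_ge0.
have zn : z <= n%:R by rewrite ler_piMr.
pose q := Num.truncn z.
have /andP[qz zq] := truncn_itv z0; rewrite -/q in qz zq.
have -> : (\sum_(k < n) (k.+1%:R <= z)%R = q)%N.
  have qn : (q <= n)%N by rewrite -(ler_nat R) (le_trans qz).
  under eq_bigr do rewrite -truncn_ge_nat//.
  by rewrite sum_ltn; exact/minn_idPr.
rewrite -natr1 in zq; rewrite ler_norml; lra.
Qed.

Let staircase_approx n s : `|staircase n n s - n%:R * (phi s * y s)| <= `|y s|.
Proof.
have -> : staircase n n s = (\sum_(k < n) (k.+1%:R <= n%:R * phi s)%R)%N%:R * y s.
  rewrite natr_sum mulr_suml; apply: eq_bigr => k _.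
  rewrite patchE /level; case: ifPn.
    by rewrite inE/= => ->; rewrite mul1r.
  by rewrite notin_setE/= => /negP/negbTE ->; rewrite mul0r.
by rewrite mulrA -mulrBl normrM ler_piMl// count_levels.
Qed.

(** The integral of a staircase approximating n phi is a sum of integrals over
    superlevel sets, hence nonnegative.  The error is at most the integral of |y|,
    uniformly in n, so that n times the integral is bounded below. *)
Lemma weighted_integral_ge0 : 0 <= \int[mu]_(s in `[0, t]) (phi s * y s).
Proof.
have Iy : mu.-integrable `[0, t] (EFin \o (fun s => `|y s|)).
  exact: (integrable_norm y_int).
have bound n : (0 < n)%N ->
    - (\int[mu]_(s in `[0, t]) `|y s|) <= n%:R * \int[mu]_(s in `[0, t]) (phi s * y s).
  move=> n0; have [I0 S0] := staircase_ge0 n n0.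
  rewrite -RintegralZl//; last exact: integrable_weight.
  apply: le_trans (_ : \int[mu]_(s in `[0, t]) (staircase n n s - `|y s|) <= _).
    by rewrite RintegralB// lerBrDr addrC subrr.
  apply: le_Rintegral => //; first exact: Rintegrable_sub.
    by apply: Rintegrable_scale => //; exact: integrable_weight.
  move=> s _; have := staircase_approx n s; rewrite ler_norml => /andP[_].
  by rewrite lerBlDr addrC -lerBlDr.
rewrite leNgt; apply/negP => neg.
set X := Rintegral _ _ _ in neg bound; set Y := Rintegral _ _ _ in bound.
pose n := Num.truncn (Y / - X).
have := bound n.+1 isT; have := truncnS_gt (Y / - X).
rewrite -/n ltr_pdivrMr ?oppr_gt0//; lra.
Qed.
End monotone_weight.

(** * Smooth plateaus *)

Section smoothstep.
Context {R : realType}.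
Implicit Types u v x h c e : R.

Definition pospart u : R := (u + `|u|) / 2.

Lemma pospart_ge0E u : 0 <= u -> pospart u = u.
Proof. by move=> u0; rewrite /pospart ger0_norm//; lra. Qed.

Lemma pospart_le0E u : u <= 0 -> pospart u = 0.
Proof. by move=> u0; rewrite /pospart ler0_norm//; lra. Qed.

Lemma continuous_pospart : continuous pospart.
Proof.
move=> u; apply: cvgMl; apply: cvgD; first exact: cvg_id.
exact: norm_continuous.
Qed.

(** The square of the positive part is C^1, with derivative twice the positive part.
    Stating this with a quadratic remainder avoids a separate treatment of the
    junction at 0. *)
Lemma pospart_sqr_taylor u v :
  `|pospart v ^+ 2 - pospart u ^+ 2 - 2 * pospart u * (v - u)| <= (v - u) ^+ 2.
Proof.
have d0 := sqr_ge0 (v - u); have v2 := sqr_ge0 v; have u2 := sqr_ge0 u.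
have [u0|u0] := leP 0 u; have [v0|v0] := leP 0 v.
- by rewrite !pospart_ge0E// ler_norml; apply/andP; split; lra.
- have uv : 0 <= u * - v by rewrite mulr_ge0// oppr_ge0 ltW.
  by rewrite (pospart_ge0E u0) (pospart_le0E (ltW v0)) ler_norml; apply/andP; split; lra.
- have uv : 0 <= - u * v by rewrite mulr_ge0// oppr_ge0 ltW.
  by rewrite (pospart_ge0E v0) (pospart_le0E (ltW u0)) ler_norml; apply/andP; split; lra.
- by rewrite (pospart_le0E (ltW u0)) (pospart_le0E (ltW v0)) ler_norml; apply/andP; split; lra.
Qed.

(** A second difference of the squared positive part: a C^1 function that rises from
    0 to 1 on [0, 2].  Its derivative is the hat function below. *)
Definition smoothstep u : R :=
  (pospart u ^+ 2 - 2 * pospart (u - 1) ^+ 2 + pospart (u - 2) ^+ 2) / 2.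

Definition hat u : R := pospart u - 2 * pospart (u - 1) + pospart (u - 2).

Lemma continuous_hat : continuous hat.
Proof.
have c a : continuous (fun u => pospart (u - a)).
  move=> u; apply: (@continuous_comp _ _ _ (fun u => u - a) pospart).
    by apply: cvgB; [exact: cvg_id | exact: cvg_cst].
  exact: continuous_pospart.
move=> u; apply: cvgD; last exact: c.
by apply: cvgB; [exact: continuous_pospart | apply: cvgMr; exact: c].
Qed.

Lemma smoothstep_taylor u v :
  `|smoothstep v - smoothstep u - hat u * (v - u)| <= 2 * (v - u) ^+ 2.
Proof.
have := pospart_sqr_taylor u v.
have := pospart_sqr_taylor (u - 1) (v - 1).
have := pospart_sqr_taylor (u - 2) (v - 2).
have -> : v - 2 - (u - 2) = v - u by ring.
have -> : v - 1 - (u - 1) = v - u by ring.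
rewrite /smoothstep /hat !ler_norml => /andP[h1 h2] /andP[h3 h4] /andP[h5 h6].
by apply/andP; split; lra.
Qed.

Lemma smoothstep_le0 u : u <= 0 -> smoothstep u = 0.
Proof. move=> u0; rewrite /smoothstep !pospart_le0E; lra. Qed.

Lemma smoothstep_ge2 u : 2 <= u -> smoothstep u = 1.
Proof. move=> u0; rewrite /smoothstep !pospart_ge0E; lra. Qed.

Lemma hat_le0 u : u <= 0 -> hat u = 0.
Proof. move=> u0; rewrite /hat !pospart_le0E; lra. Qed.

Lemma hat_ge2 u : 2 <= u -> hat u = 0.
Proof. move=> u0; rewrite /hat !pospart_ge0E; lra. Qed.

Lemma smoothstep_itv u : 0 <= smoothstep u <= 1.
Proof.
have [u0|u0] := leP u 0; first by rewrite smoothstep_le0// lexx ler01.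
have [u2|u2] := leP 2 u; first by rewrite smoothstep_ge2// lexx ler01.
rewrite /smoothstep (pospart_ge0E (ltW u0)) (@pospart_le0E (u - 2)); last lra.
have [u1|u1] := leP 1 u.
  rewrite pospart_ge0E; last lra.
  by apply/andP; split; nra.
rewrite pospart_le0E; last lra.
by apply/andP; split; nra.
Qed.

Lemma hat_ge0 u : 0 <= hat u.
Proof.
have [u0|u0] := leP u 0; first by rewrite hat_le0.
have [u2|u2] := leP 2 u; first by rewrite hat_ge2.
rewrite /hat (pospart_ge0E (ltW u0)) (@pospart_le0E (u - 2)); last lra.
have [u1|u1] := leP 1 u; [rewrite pospart_ge0E|rewrite pospart_le0E]; lra.
Qed.

Lemma is_derive_taylor (f : R -> R) x l C :
  (forall v, `|f v - f x - l * (v - x)| <= C * (v - x) ^+ 2) -> is_derive x 1 f l.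
Proof.
move=> H.
have C0 : 0 <= C.
  have := H (x + 1); have -> : x + 1 - x = 1 by ring.
  by rewrite expr1n [leRHS]mulr1 => /(le_trans (normr_ge0 _)).
have cv : h^-1 *: (f (h *: 1 + x) - f x) @[h --> 0^'] --> l.
  apply/cvgrPdist_le => e e0; near=> h.
  have h0 : h != 0 by near: h; exact: nbhs_dnbhs_neq.
  have hn : 0 < `|h| by rewrite normr_gt0.
  have := H (h + x); rewrite addrK => Hh.
  rewrite /GRing.scale/= mulr1 -(ler_pM2r hn) -normrM mulrBl mulrAC mulVf// mul1r distrC.
  apply: (le_trans Hh); rewrite -(real_normK (num_real h)) expr2 mulrA ler_pM2r//.
  have : `|h| <= e / (C + 1).
    by near: h; apply: dnbhs0_le; rewrite divr_gt0// ltr_pwDr.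
  rewrite ler_pdivlMr ?ltr_pwDr// => hC; apply: le_trans hC.
  by rewrite mulrC ler_wpM2l// lerDl.
split; first by apply/cvg_ex; exists l.
exact: (cvg_lim _ cv).
Unshelve. all: end_near. Qed.

Lemma is_derive_smoothstep c e x : 0 < e ->
  is_derive x 1 (fun v => smoothstep ((v - c) / e)) (hat ((x - c) / e) / e).
Proof.
move=> e0; apply: (@is_derive_taylor _ _ _ (2 / e ^+ 2)) => v.
have := smoothstep_taylor ((x - c) / e) ((v - c) / e).
have -> : (v - c) / e - (x - c) / e = (v - x) / e by ring.
have -> : hat ((x - c) / e) / e * (v - x) = hat ((x - c) / e) * ((v - x) / e) by ring.
by have -> : 2 / e ^+ 2 * (v - x) ^+ 2 = 2 * ((v - x) / e) ^+ 2 by rewrite exprMn exprVn; ring.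
Qed.

Lemma continuous_hat_scaled c e : continuous (fun v => hat ((v - c) / e) / e).
Proof.
move=> u; apply: cvgMl; apply: (@continuous_comp _ _ _ (fun u => (u - c) / e) hat).
  by apply: cvgMl; apply: cvgB; [exact: cvg_id | exact: cvg_cst].
exact: continuous_hat.
Qed.
End smoothstep.

(** * Continuous functions are primitives of their weak derivatives *)

Section weak_derivative_FTC.
Context {R : realType}.
Local Notation mu := (@lebesgue_measure R).
Implicit Types (T c e s t r : R) (x y : R -> R).

Lemma Rintegral_itv_oo_cc (a b : R) (f : R -> R) :
  mu.-integrable `[a, b] (EFin \o f) ->
  \int[mu]_(t in `]a, b[) f t = \int[mu]_(t in `[a, b]) f t.
Proof.
move=> If; rewrite Rintegral_itv_bndo_bndc ?Rintegral_itv_obnd_cbnd//.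
- apply: (integrableS _ _ _ If) => // r; rewrite /= !in_itv/= => /andP[/ltW -> ->] //.
- apply: (integrableS _ _ _ If) => // r; rewrite /= !in_itv/= => /andP[/ltW -> /ltW ->] //.
Qed.

Lemma integral_hat T c e : 0 < e -> 0 <= c -> c + 2 * e <= T ->
  \int[mu]_(r in `]0, T[) (hat ((r - c) / e) / e) = 1.
Proof.
move=> e0 c0 cT.
have T0 : 0 < T by lra.
have ch := @continuous_hat_scaled R c e.
rewrite Rintegral_itv_oo_cc; last first.
  apply: continuous_compact_integrable; first exact: segment_compact.
  exact: continuous_subspaceT.
pose F v := smoothstep ((v - c) / e).
have cF : continuous F.
  move=> v; apply: differentiable_continuous; apply/derivable1_diffP.
  by case: (is_derive_smoothstep c v e0).
rewrite /Rintegral (@continuous_FTC2 _ _ F) //=.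
- rewrite /F smoothstep_ge2; last by rewrite ler_pdivlMr//; lra.
  by rewrite smoothstep_le0 ?subr0// ler_pdivrMr//; lra.
- exact: continuous_subspaceT.
- split; first by move=> v _; case: (is_derive_smoothstep c v e0).
  + by apply: cvg_at_right_filter; exact: cF.
  + by apply: cvg_at_left_filter; exact: cF.
- by move=> v _; rewrite derive1E; case: (is_derive_smoothstep c v e0).
Qed.

(** The rescaled hat is nonnegative with integral 1, and is supported in
    [c, c + 2 e]. *)
Lemma hat_average T c e (x : R -> R) (p eps : R) : 0 < e -> 0 <= c -> c + 2 * e <= T ->
  {within `[0, T], continuous x} ->
  (forall r, c <= r <= c + 2 * e -> `|x r - p| <= eps) ->
  `|\int[mu]_(r in `]0, T[) (x r * (hat ((r - c) / e) / e)) - p| <= eps.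
Proof.
move=> e0 c0 cT cx xp.
have h0 r : 0 <= hat ((r - c) / e) / e by rewrite divr_ge0 ?hat_ge0// ltW.
have sub : `]0, T[ `<=` `[0, T] by move=> r; rewrite /= !in_itv/= => /andP[/ltW -> /ltW ->].
have Ih : mu.-integrable `]0, T[ (EFin \o (fun r => hat ((r - c) / e) / e)).
  apply: (@integrableS _ _ _ mu `[0, T]%classic) => //.
  apply: continuous_compact_integrable; first exact: segment_compact.
  exact: (continuous_subspaceT (@continuous_hat_scaled R c e)).
have Ixh : mu.-integrable `]0, T[ (EFin \o (fun r => x r * (hat ((r - c) / e) / e))).
  apply: (@integrableS _ _ _ mu `[0, T]%classic) => //.
  apply: continuous_compact_integrable; first exact: segment_compact.
  move=> r; apply: cvgM; first exact: cx.
  exact: (continuous_subspaceT (@continuous_hat_scaled R c e)).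
have -> : p = \int[mu]_(r in `]0, T[) (p * (hat ((r - c) / e) / e)).
  by rewrite RintegralZl// integral_hat// mulr1.
rewrite -RintegralB//; last exact: Rintegrable_scale.
have Id := Rintegrable_sub Ixh (Rintegrable_scale p Ih (measurable_itv _)) (measurable_itv _).
apply: le_trans (le_normr_Rintegral _ Id) _ => //.
have -> : eps = \int[mu]_(r in `]0, T[) (eps * (hat ((r - c) / e) / e)).
  by rewrite RintegralZl// integral_hat// mulr1.
apply: le_Rintegral => //.
- exact: (integrable_norm Id).
- exact: Rintegrable_scale.
move=> r _; rewrite -mulrBl normrM (ger0_norm (h0 r)).
have [rc|cr] := ltP r c.
  by rewrite hat_le0 ?mul0r ?mulr0// ler_pdivrMr//; lra.
have [ce|rce] := ltP (c + 2 * e) r.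
  by rewrite hat_ge2 ?mul0r ?mulr0// ler_pdivlMr//; lra.
by rewrite ler_wpM2r// xp// cr.
Qed.

(** It rises from 0 to 1 on [s + e, s + 3 e] and falls back to 0 on
    [t - 4 e, t - 2 e], so that its support stays inside ]s, t[ even if s and t are the
    endpoints of the domain. *)
Definition plateau s t e r : R :=
  smoothstep ((r - (s + e)) / e) - smoothstep ((r - (t - 4 * e)) / e).

Lemma plateau_norm_le1 s t e r : `|plateau s t e r| <= 1.
Proof.
rewrite /plateau; have /andP[] := smoothstep_itv ((r - (s + e)) / e).
have /andP[] := smoothstep_itv ((r - (t - 4 * e)) / e).
by rewrite ler_norml => *; apply/andP; split; lra.
Qed.

Lemma is_derive_plateau s t e r : 0 < e -> is_derive r 1 (plateau s t e)
  (hat ((r - (s + e)) / e) / e - hat ((r - (t - 4 * e)) / e) / e).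
Proof.
by move=> e0; apply: is_deriveB; exact: is_derive_smoothstep.
Qed.

Lemma test_function_plateau T s t e : 0 <= s -> t <= T -> 0 < e -> 6 * e < t - s ->
  test_function T (plateau s t e).
Proof.
move=> s0 tT e0 est.
have dE : derive1 (plateau s t e) = (fun r =>
    hat ((r - (s + e)) / e) / e - hat ((r - (t - 4 * e)) / e) / e).
  apply/funext => r; rewrite derive1E.
  by case: (is_derive_plateau s t r e0).
have cl : closure [set r | plateau s t e r != 0] `<=` `[s + e, t - 2 * e].
  rewrite [X in _ `<=` X](closure_id _).1; last exact: itv_closed.
  apply: closure_subset => r /=; rewrite in_itv/=; apply: contraR.
  rewrite negb_and -!ltNge /plateau => /orP[h|h].
    by rewrite !smoothstep_le0 ?subrr// ler_pdivrMr//; lra.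
  by rewrite !smoothstep_ge2 ?subrr// ler_pdivlMr//; lra.
split.
- by move=> r; case: (is_derive_plateau s t r e0).
- by rewrite dE => r; apply: cvgB; exact: continuous_hat_scaled.
- apply: (subclosed_compact _ (@segment_compact _ _ _) cl); exact: closed_closure.
- by move=> r /cl /=; rewrite !in_itv/= => /andP[h1 h2]; apply/andP; split; lra.
Qed.

(** On a bounded interval |y| <= 1 + |y|^2 is integrable. *)
Lemma L2_integrable T (y : R -> R) : L2 T y -> mu.-integrable `[0, T] (EFin \o y).
Proof.
move=> Ly.
have my : measurable_fun `]0, T[ y.
  move: Ly; rewrite /L2 inE => /andP[/[!inE]/= my _].
  by apply/(measurable_restrictT y (measurable_itv _)).
have le12 : 1 <= 2 :> R by rewrite ler1n.
have I2 : mu.-integrable `]0, T[ (EFin \o (fun r => `|(y \_ `]0, T[) r| `^ 2)).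
  exact: (integrableS _ _ _ (Lfun_integrable le12 Ly)).
have I1 : mu.-integrable `]0, T[ (EFin \o cst 1).
  apply: (@integrableS _ _ _ mu `[0, T]%classic) => //.
    by move=> r; rewrite /= !in_itv/= => /andP[/ltW -> /ltW ->].
  apply: continuous_compact_integrable; first exact: segment_compact.
  by move=> r; exact: cvg_cst.
have Iy : mu.-integrable `]0, T[ (EFin \o y).
  apply: (le_integrable _ _ _ (Rintegrable_add I1 I2 (measurable_itv _))) => //.
    exact/measurable_EFinP.
  move=> r Dr; rewrite lee_fin patchE mem_set// powR_mulrn//=.
  apply: le_trans (ler_norm _).
  by have := sqr_ge0 (`|y r| - 1); have := normr_ge0 (y r); lra.
apply/integrableP; split.
  by apply/measurable_EFinP/measurable_fun_itv_obnd_cbndP/measurable_fun_itv_bndo_bndcP.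
rewrite -integral_itv_obnd_cbnd; last first.
  apply: measurableT_comp => //; apply/measurable_EFinP.
  exact/measurable_fun_itv_bndo_bndcP.
rewrite -integral_itv_bndo_bndc; last first.
  by apply: measurableT_comp => //; exact/measurable_EFinP.
by case/integrableP : Iy.
Qed.

Lemma within_continuous_dist T (x : R -> R) s eps : {within `[0, T], continuous x} ->
  0 <= s <= T -> 0 < eps ->
  exists2 d, 0 < d & forall r, 0 <= r <= T -> `|r - s| < d -> `|x r - x s| <= eps.
Proof.
move=> /subspace_continuousP cx sT eps0.
have : x r @[r --> within `[0, T]%classic (nbhs s)] --> x s by apply: cx; rewrite /= in_itv.
move=> /cvgrPdist_le /(_ _ eps0); rewrite near_withinE => /nbhs_ballP[d d0 H].
exists d => // r rT rs; rewrite distrC; apply: H; last by rewrite /= in_itv.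
by rewrite /ball/= distrC.
Qed.

(** Test against the plateaus between s and t.  On one side the hats concentrate at s
    and t, which gives x s - x t by continuity; on the other side the plateaus
    converge to the indicator of ]s, t[. *)
Theorem weak_derivative_FTC T x y s t : {within `[0, T], continuous x} ->
  is_weak_derivative T x y -> 0 <= s -> s <= t -> t <= T ->
  \int[mu]_(r in `[s, t]) y r = x t - x s.
Proof.
move=> cx [Ly wd] s0; rewrite le_eqVlt => /predU1P[<-|st] tT.
  by rewrite set_itv1 Rintegral_set1 subrr.
have Iy := L2_integrable Ly.
have sub : `]0, T[ `<=` `[0, T] by move=> r; rewrite /= !in_itv/= => /andP[/ltW -> /ltW ->].
have Iy' : mu.-integrable `]0, T[ (EFin \o y) by apply: integrableS Iy.
(* 7 rather than 6, for the strict inequality 6 * e n < t - s. *)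
pose e n : R := (t - s) / n.+1%:R / 7.
have e0 n : 0 < e n by rewrite !divr_gt0 ?subr_gt0.
have e_lim : e n @[n --> \oo] --> 0.
  suff : (t - s) / n.+1%:R / 7 @[n --> \oo] --> (t - s) * 0 / 7 by rewrite mulr0 mul0r.
  by apply: cvgMl; apply: cvgMr; exact: cvg_harmonic.
have est n : 6 * e n < t - s.
  have n1 : (t - s) / n.+1%:R <= t - s.
    by rewrite ler_pdivrMr// ler_peMr ?ler1n// subr_ge0 ltW.
  have := e0 n; rewrite /e; move: n1; set A := (t - s) / _; lra.
pose I n := \int[mu]_(r in `]0, T[) (x r * derive1 (plateau s t (e n)) r).
have left_lim (lo : R) (c : nat -> R) : 0 <= lo <= T ->
    (forall n, [/\ 0 <= c n, c n + 2 * e n <= T & `|c n - lo| <= 4 * e n]) ->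
    \int[mu]_(r in `]0, T[) (x r * (hat ((r - c n) / e n) / e n)) @[n --> \oo] --> x lo.
  move=> loT cn; apply/cvgrPdist_le => eps eps0.
  have [d d0 Hd] := within_continuous_dist cx loT eps0.
  near=> n; have [c0 cT cl] := cn n.
  rewrite distrC; apply: hat_average => // r /andP[cr rc].
  have en : e n < d / 6.
    by near: n; apply: (cvgr_lt _ e_lim); rewrite divr_gt0.
  have := e0 n => en0; apply: Hd; first by apply/andP; split; lra.
  have -> : r - lo = (r - c n) + (c n - lo) by ring.
  apply: le_lt_trans (ler_normD _ _) _.
  have : `|r - c n| <= 2 * e n by rewrite ger0_norm; lra.
  lra.
have lim_x : I n @[n --> \oo] --> x s - x t.
  have IE n : I n = \int[mu]_(r in `]0, T[) (x r * (hat ((r - (s + e n)) / e n) / e n)) -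
     \int[mu]_(r in `]0, T[) (x r * (hat ((r - (t - 4 * e n)) / e n) / e n)).
    have Ixh c : mu.-integrable `]0, T[ (EFin \o (fun r => x r * (hat ((r - c) / e n) / e n))).
      apply: (@integrableS _ _ _ mu `[0, T]%classic) => //.
      apply: continuous_compact_integrable; first exact: segment_compact.
      move=> r; apply: cvgM; first exact: cx.
      exact: (continuous_subspaceT (@continuous_hat_scaled R c (e n))).
    rewrite -RintegralB//; apply: eq_Rintegral => r _.
    have d := is_derive_plateau s t r (e0 n).
    by rewrite derive1E derive_val mulrBr.
  rewrite (funext IE); apply: cvgB; apply: left_lim => [|n].
  - by apply/andP; split; lra.
  - have := e0 n; have := est n; split; [lra|lra|].
    by rewrite addrC addKr ger0_norm; lra.
  - by apply/andP; split; lra.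
  - have := e0 n; have := est n; split; [lra|lra|].
    have -> : t - 4 * e n - t = - (4 * e n) by ring.
    by rewrite normrN ger0_norm; lra.
have lim_y : I n @[n --> \oo] --> - \int[mu]_(r in `]s, t[) y r.
  have IE n : I n = - \int[mu]_(r in `]0, T[) (y r * plateau s t (e n) r).
    by apply: wd; apply: test_function_plateau.
  rewrite (funext IE); apply: cvgN.
  have plateau_lim r : y r * plateau s t (e n) r @[n --> \oo] --> (y \_ `]s, t[) r.
    apply: cvg_near_cst; rewrite patchE; case: ifPn.
      rewrite inE/= in_itv/= => /andP[sr rt]; near=> n.
      have h1 : e n < (r - s) / 3.
        by near: n; apply: (cvgr_lt _ e_lim); rewrite divr_gt0// subr_gt0.
      have h2 : e n < (t - r) / 4.
        by near: n; apply: (cvgr_lt _ e_lim); rewrite divr_gt0// subr_gt0.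
      rewrite /plateau smoothstep_ge2; last by rewrite ler_pdivlMr//; lra.
      by rewrite smoothstep_le0 ?subr0 ?mulr1// ler_pdivrMr//; lra.
    rewrite notin_setE/= in_itv/= => /negP; rewrite negb_and -!leNgt => h.
    apply: nearW => n; have := e0 n; have := est n => h1 h2; case/orP: h => h.
      by rewrite /plateau !smoothstep_le0 ?subrr ?mulr0// ler_pdivrMr//; lra.
    by rewrite /plateau !smoothstep_ge2 ?subrr ?mulr0// ler_pdivlMr//; lra.
  have sub_st : `]s, t[ `<=` `]0, T[.
    by move=> r; rewrite /= !in_itv/= => /andP[h1 h2]; apply/andP; split; lra.
  have my : measurable_fun `]0, T[ y by apply/measurable_EFinP; exact: (measurable_int mu).
  have mplateau n : measurable_fun `]0, T[ (plateau s t (e n)).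
    apply: measurable_funTS; apply: continuous_measurable_fun => r.
    apply: differentiable_continuous; apply/derivable1_diffP.
    by case: (is_derive_plateau s t r (e0 n)).
  have -> : \int[mu]_(r in `]s, t[) y r = \int[mu]_(r in `]0, T[) (y \_ `]s, t[) r.
    by rewrite -Rintegral_mkcondr setIidr.
  have [|||||Ilim _ lim] := @dominated_convergence _ _ _ mu `]0, T[%classic (measurable_itv _)
    (fun n r => (y r * plateau s t (e n) r)%:E) (EFin \o (y \_ `]s, t[))
    (EFin \o (fun r => `|y r|)).
  - by move=> n; apply/measurable_EFinP; apply: measurable_funM; [exact: my|exact: mplateau].
  - apply/measurable_EFinP; apply/measurable_restrict => //.
    by rewrite setIidr//; apply: measurable_funS my.
  - apply: aeW => r _; apply: cvg_EFin; first exact: nearW.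
    exact: plateau_lim.
  - exact: (integrable_norm Iy').
  - apply: aeW => r n _; rewrite lee_fin normrM ler_piMr//.
    exact: plateau_norm_le1.
  have fin : (\int[mu]_(r in `]0%R, T[) (EFin \o (y \_ `]s, t[)) r)%E \is a fin_num.
    exact: integrable_fin_num Ilim.
  by apply: fine_cvg; rewrite fineK.
have Iyst : mu.-integrable `[s, t] (EFin \o y).
  apply: integrableS Iy => // r; rewrite /= !in_itv/= => /andP[h1 h2].
  by rewrite (le_trans s0 h1) (le_trans h2 tT).
have E : x s - x t = - \int[mu]_(r in `]s, t[) y r by exact: (cvg_unique (@Rhausdorff R) lim_x lim_y).
rewrite Rintegral_itv_oo_cc// in E; lra.
Unshelve. all: end_near. Qed.
End weak_derivative_FTC.

(** * Comparison at the first crossing *)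

Section comparison.
Context {R : realType}.
Local Notation mu := (@lebesgue_measure R).
Implicit Types (T a s t r : R) (x y v : R -> R).

(** A strict inequality F t > G t would persist on a nondegenerate interval, which is
    not negligible. *)
Lemma ae_le_within T (F G : R -> R) : 0 < T ->
  {within `[0, T], continuous F} -> {within `[0, T], continuous G} ->
  {ae mu, forall t, 0 <= t <= T -> F t <= G t} ->
  forall t, 0 <= t <= T -> F t <= G t.
Proof.
move=> T0 cF cG [A [mA A0 sA]] t tT; rewrite leNgt; apply/negP => GF.
pose h r := F r - G r.
have ch : {within `[0, T], continuous h} by move=> r; apply: cvgB; [exact: cF|exact: cG].
have ht : 0 < h t by rewrite subr_gt0.
have ht2 : 0 < h t / 2 by rewrite divr_gt0.
have [d d0 H] := within_continuous_dist ch tT ht2.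
pose lo := Num.max 0 (t - d); pose hi := Num.min T (t + d).
have [t0 tT'] := andP tT.
have lohi : lo < hi.
  rewrite /lo /hi gt_max !lt_min T0/=; apply/andP; split; first lra.
  by apply/andP; split; lra.
have sub : `]lo, hi[ `<=` A.
  move=> r; rewrite /= in_itv/= /lo /hi gt_max lt_min => /andP[/andP[r0 rd] /andP[rT rd']].
  apply: sA => /= /(_ _) K.
  have rT01 : 0 <= r <= T by rewrite !ltW.
  have := H r rT01; rewrite ltr_norml ler_norml => /(_ _)/andP[].
    by apply/andP; split; lra.
  by have := K rT01; rewrite /h; lra.
have : (mu `]lo, hi[ <= mu A)%E by apply: le_measure => //; rewrite inE.
rewrite A0 lebesgue_measure_itv/= lte_fin lohi -EFinD lee_fin; lra.
Qed.

Lemma graph_continuous T (F : R * R -> R) v :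
  {within `[0, T] `*` [set: R], continuous F} -> {within `[0, T], continuous v} ->
  {within `[0, T], continuous (fun t => F (t, v t))}.
Proof.
move=> /subspace_continuousP cF /subspace_continuousP cv.
apply/subspace_continuousP => t tT; apply/cvgrPdist_lt => e e0.
have := cF (t, v t) (conj tT I) => /cvgrPdist_lt /(_ _ e0); rewrite near_withinE => -[[A B] [/= nA nB] AB].
have inT : \forall r \near within `[0, T]%classic (nbhs t), `[0, T]%classic r.
  exact: withinT.
have inA : \forall r \near within `[0, T]%classic (nbhs t), A r by exact: (@cvg_within _ (nbhs t) _ _ A nA).
have inB : \forall r \near within `[0, T]%classic (nbhs t), B (v r) by exact: (cv t tT _ nB).
near=> r; apply: (AB (r, v r)) => /=.
  by split; [near: r; exact: inA | near: r; exact: inB].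
by split => //; near: r; exact: inT.
Unshelve. all: end_near. Qed.

(** The elapsed time t - r, extended from [0, t] by clamping, so that the weights built
    from it are monotone and bounded on the whole line. *)
Definition kernel_time t r : R := Num.max 0 (t - Num.max 0 r).

Lemma kernel_time_itv t r : 0 <= t -> 0 <= kernel_time t r <= t.
Proof.
move=> t0; rewrite /kernel_time le_max lexx/= ge_max t0/= lerBlDr lerDl.
by rewrite le_max lexx.
Qed.

Lemma kernel_time_homo t r s : r <= s -> kernel_time t s <= kernel_time t r.
Proof.
move=> rs; rewrite /kernel_time ge_max le_max lexx/= le_max; apply/orP; right.
by rewrite lerB// ge_max le_max lexx/= le_max rs orbT.
Qed.

Lemma kernel_timeE t r : 0 <= r <= t -> kernel_time t r = t - r.
Proof. by case/andP=> r0 rt; rewrite /kernel_time (max_idPr r0); apply/max_idPr; rewrite subr_ge0. Qed.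

(** The kernel r |-> K (t - r) is the sum of its least value K t > 0 and of a
    nonnegative nondecreasing weight.  Integrated against the derivative of x1 - x2, the
    constant contributes K t (x2 0 - x1 0) > 0 and the weight contributes a nonnegative
    amount. *)
Lemma ABC_lt (B : R -> R) T a x1 x2 t : 0 < B a -> 0 < a < 1 ->
  {within `[0, T], continuous x1} -> {within `[0, T], continuous x2} ->
  H1 T x1 -> H1 T x2 -> 0 < t <= T ->
  (forall s, 0 <= s < t -> x1 s < x2 s) -> x1 t = x2 t ->
  ABC B T a x2 t < ABC B T a x1 t.
Proof.
move=> B0 /andP[a0 a1] cx1 cx2 [_ ex1] [_ ex2] /andP[t0 tT] lt12 eq12.
have wd1 : is_weak_derivative T x1 (weak_derivative T x1) by apply: xgetPex.
have wd2 : is_weak_derivative T x2 (weak_derivative T x2) by apply: xgetPex.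
set y1 := weak_derivative T x1 in wd1 *; set y2 := weak_derivative T x2 in wd2 *.
have It y : is_weak_derivative T x1 y \/ is_weak_derivative T x2 y ->
    mu.-integrable `[0, t] (EFin \o y).
  move=> wd; have Ly : L2 T y by case: wd => -[].
  apply: integrableS (L2_integrable Ly) => // r; rewrite /= !in_itv/= => /andP[-> rt].
  exact: le_trans rt tT.
have I1 := It y1 (or_introl wd1); have I2 := It y2 (or_intror wd2).
pose lam := a / (1 - a).
have lam0 : 0 <= lam by rewrite divr_ge0 ?ltW// subr_gt0.
have lamK u : 0 <= lam * u `^ a by rewrite mulr_ge0 ?powR_ge0.
have a01 : 0 < a <= 1 by rewrite a0 ltW.
pose phi r := mittag_leffler a (- (lam * kernel_time t r `^ a)).
pose kap := mittag_leffler a (- (lam * t `^ a)).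
have kap0 : 0 < kap by exact: mittag_leffler_gt0.
have phi_homo : {homo phi : r s / r <= s}.
  move=> r s rs; apply: (mittag_leffler_homo a01 (lamK _)).
  rewrite ler_wpM2l// ge0_ler_powR ?nnegrE ?(ltW a0) ?kernel_time_homo//.
    by case/andP: (kernel_time_itv s (ltW t0)).
  by case/andP: (kernel_time_itv r (ltW t0)).
have phi_itv r : kap <= phi r <= 1.
  have /andP[k0 kt] := kernel_time_itv r (ltW t0).
  apply/andP; split.
    apply: (mittag_leffler_homo a01 (lamK _)).
    by rewrite ler_wpM2l// ge0_ler_powR ?nnegrE ?(ltW a0) ?(ltW t0).
  rewrite -(mittag_leffler0 a) -oppr0; exact: (mittag_leffler_homo a01).
have phi01 r : 0 <= phi r <= 1.
  by have /andP[h ->] := phi_itv r; rewrite (le_trans (ltW kap0) h).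
have ABCE x : ABC B T a x t = B a / (1 - a) *
    \int[mu]_(r in `[0, t]) (phi r * weak_derivative T x r).
  rewrite /ABC; congr (_ * _); apply: eq_Rintegral => r.
  by rewrite inE/= in_itv/= => rt; rewrite /phi kernel_timeE// mulNr.
rewrite !ABCE ltr_pM2l ?divr_gt0 ?subr_gt0// -/y1 -/y2 -subr_gt0.
have Iphi1 := integrable_weight I1 phi_homo phi01.
have Iphi2 := integrable_weight I2 phi_homo phi01.
pose y r := y1 r - y2 r.
have Iy : mu.-integrable `[0, t] (EFin \o y) by exact: Rintegrable_sub.
have tail s : 0 <= s <= t -> \int[mu]_(r in `[s, t]) y r = x2 s - x1 s.
  case/andP=> s0 st.
  have sub r : `[s, t]%classic r -> `[0, t]%classic r.
    by rewrite /= !in_itv/= => /andP[sr ->]; rewrite (le_trans s0 sr).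
  rewrite RintegralB//; [|exact: integrableS I1|exact: integrableS I2].
  rewrite (weak_derivative_FTC cx1 wd1)// (weak_derivative_FTC cx2 wd2)// eq12; ring.
have tail0 s : 0 <= s <= t -> 0 <= \int[mu]_(r in `[s, t]) y r.
  move=> /[dup] st /andP[s0]; rewrite tail// le_eqVlt => /predU1P[->|s1].
    by rewrite eq12 subrr.
  by rewrite subr_ge0 ltW// lt12// s0.
pose psi r := phi r - kap.
have psi_homo : {homo psi : r s / r <= s} by move=> r s rs; rewrite lerD2r phi_homo.
have psi01 r : 0 <= psi r <= 1.
  by have /andP[h1 h2] := phi_itv r; rewrite subr_ge0 h1/= lerBlDr (le_trans h2)// lerDl ltW.
have Ipsi := integrable_weight Iy psi_homo psi01.
rewrite -RintegralB//.
have -> : \int[mu]_(r in `[0, t]) (phi r * y1 r - phi r * y2 r) =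
    \int[mu]_(r in `[0, t]) (psi r * y r + kap * y r).
  by apply: eq_Rintegral => r _; rewrite /psi /y; ring.
rewrite RintegralD//; last exact: Rintegrable_scale.
rewrite RintegralZl// tail ?lexx ?ltW// ltr_wpDl ?mulr_gt0//.
  exact: (weighted_integral_ge0 Iy psi_homo tail0 psi01).
by rewrite subr_gt0 lt12// lexx.
Qed.

Lemma first_crossing T (d : R -> R) t : {within `[0, T], continuous d} ->
  0 < d 0 -> 0 <= t <= T -> d t <= 0 ->
  exists s, [/\ 0 < s <= T, d s = 0 & forall r, 0 <= r < s -> 0 < d r].
Proof.
move=> cd d0 tT dt.
pose Z := [set r | 0 <= r <= T /\ d r <= 0].
have Zt : Z t by split.
have Zn : Z !=set0 by exists t.
have lbZ : has_lbound Z by exists 0 => r [/andP[]].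
pose s := inf Z.
have st : s <= t by exact: ge_inf.
have s0 : 0 <= s by apply: lb_le_inf => // r [/andP[]].
have sT : 0 <= s <= T by rewrite s0 (le_trans st)//; case/andP: tT.
have before r : 0 <= r < s -> 0 < d r.
  move=> /andP[r0 rs]; rewrite ltNge; apply/negP => dr.
  have : s <= r by apply: ge_inf => //; split => //; rewrite r0 (le_trans (ltW rs))//; case/andP: sT.
  by rewrite leNgt rs.
have ds_le0 : d s <= 0.
  rewrite leNgt; apply/negP => ds.
  have ds2 : 0 < d s / 2 by rewrite divr_gt0.
  have [e e0 H] := within_continuous_dist cd sT ds2.
  have [r Zr rse] : exists2 r, Z r & r < s + e by apply: inf_lt => //; rewrite ltrDl.
  have sr : s <= r by exact: ge_inf.
  case: Zr => rT dr; have := H r rT; rewrite ger0_norm ?subr_ge0// ler_norml => /(_ _)/andP[].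
    lra.
  lra.
have s_gt0 : 0 < s.
  by rewrite lt_neqAle s0 andbT; apply: contraTneq ds_le0 => <-; rewrite -ltNge.
exists s; split => //; first by rewrite s_gt0; case/andP: sT.
apply/eqP; rewrite eq_le ds_le0/= leNgt; apply/negP => ds.
(* By continuity d would be negative at a point r < s as well. *)
have ds2 : 0 < - d s / 2 by rewrite divr_gt0// oppr_gt0.
have [e e0 H] := within_continuous_dist cd sT ds2.
pose r := Num.max 0 (s - e / 2).
have r0 : 0 <= r by rewrite le_max lexx.
have rs : r < s by rewrite gt_max s_gt0/= ltrBlDr ltrDl divr_gt0.
have re : s - e / 2 <= r by rewrite le_max lexx orbT.
have := before r; rewrite r0 rs => /(_ isT) dr.
have rT : 0 <= r <= T by rewrite r0 (le_trans (ltW rs))//; case/andP: sT.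
have := H r rT; rewrite ltr_norml ler_norml => /(_ _)/andP[].
  by apply/andP; split; lra.
lra.
Qed.
End comparison.

(** * The comparison theorem *)

Unset Implicit Arguments.
Theorem theorem4p1 (R : realType) (B : R -> R) (T a : R) (f g : R * R -> R)
    (v w : R -> R)
    (V := fun t : R => v t / f (t, v t)) (W := fun t : R => w t / f (t, w t)) :
  normalization_function B ->
  0 < T -> 0 < a < 1 ->
  {within `[0, T] `*` [set: R], continuous f} ->
  (forall t x : R, 0 <= t <= T -> f (t, x) != 0) ->
  {within `[0, T] `*` [set: R], continuous g} ->
  (forall t : R, 0 <= t <= T ->
     forall x y : R, x < y -> x / f (t, x) < y / f (t, y)) ->
  {within `[0, T], continuous v} ->
  {within `[0, T], continuous w} ->
  H1 T V -> {within `[0, T], continuous (ABC B T a V)} ->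
  H1 T W -> {within `[0, T], continuous (ABC B T a W)} ->
  {ae lebesgue_measure, forall t : R, 0 <= t <= T ->
     ABC B T a V t <= g (t, v t)} ->
  {ae lebesgue_measure, forall t : R, 0 <= t <= T ->
     g (t, w t) <= ABC B T a W t} ->
  {ae lebesgue_measure, forall t : R, 0 <= t <= T ->
     ABC B T a V t < g (t, v t)} \/
  {ae lebesgue_measure, forall t : R, 0 <= t <= T ->
     g (t, w t) < ABC B T a W t} ->
  v 0 < w 0 ->
  forall t : R, 0 <= t <= T -> v t < w t.
Proof.
move=> [B_gt0 _ _] T0 a01 cf f0 cg mono cv cw HV cAV HW cAW leV leW _ vw0 t tT.
have mono_le (r x y : R) : 0 <= r <= T -> x <= y -> x / f (r, x) <= y / f (r, y).
  move=> rT; rewrite le_eqVlt => /predU1P[->//|xy]; exact/ltW/mono.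
have quotient_continuous (u : R -> R) : {within `[0, T], continuous u} ->
    {within `[0, T], continuous (fun r => u r / f (r, u r))}.
  move=> cu; have cfu := graph_continuous cf cu.
  apply/subspace_continuousP => r rT; apply: cvgM.
    by move/subspace_continuousP : cu; apply.
  apply: cvgV; first by apply: f0; move: rT; rewrite /= in_itv.
  by move/subspace_continuousP : cfu; apply.
have cV : {within `[0, T], continuous V} by exact: quotient_continuous.
have cW : {within `[0, T], continuous W} by exact: quotient_continuous.
rewrite ltNge; apply/negP => wv.
have cd : {within `[0, T], continuous (fun r => W r - V r)}.
  by move=> r; apply: cvgB; [exact: cW|exact: cV].
have T00 : 0 <= (0 : R) <= T by apply/andP; split => //; exact: ltW.
have [|||s [sT ds before]] := first_crossing cd (t := t).
- by rewrite subr_gt0; exact: mono.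
- by [].
- by rewrite subr_le0; exact: mono_le.
have VW : V s = W s by apply/esym/eqP; rewrite -subr_eq0 ds.
have sT' : 0 <= s <= T by case/andP: sT => /ltW -> ->.
have vw : v s = w s.
  have [vw|wv'|//] := ltgtP (v s) (w s).
  - by have := mono s sT' _ _ vw; rewrite -/(V s) -/(W s) VW ltxx.
  - by have := mono s sT' _ _ wv'; rewrite -/(V s) -/(W s) VW ltxx.
have a01' : 0 <= a <= 1 by case/andP: a01 => /ltW -> /ltW ->.
have : ABC B T a W s < ABC B T a V s.
  by apply: ABC_lt => // [|r rs]; [exact: B_gt0 | rewrite -subr_gt0; exact: before].
have leV' := ae_le_within T0 cAV (graph_continuous cg cv) leV sT'.
have leW' := ae_le_within T0 (graph_continuous cg cw) cAW leW sT'.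
by rewrite ltNge (le_trans leV')// vw.
Qed.
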